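(* Assume that there exists a (complex) semisimple Lie algebra of dimension $n$, and let $[\mu]\in L_n$. Then $F_n:L_n\to\mathbb{R}$ attains its minimum value at a point $[\lambda]\in\mathrm{GL}(n).[\mu]$ if and only if $\mu$ is a semisimple Lie algebra. In such a case, $F_n([\lambda])=\frac{4}{n}$.
   Context: Let $V_n=\otimes^2(\mathbb{C}^n)^*\otimes\mathbb{C}^n$ be the space of all bilinear maps $\mu:\mathbb{C}^n\times\mathbb{C}^n\to\mathbb{C}^n$. $\mathrm{GL}(n)$ acts on $V_n$ by $g.\mu(X,Y)=g\mu(g^{-1}X,g^{-1}Y)$, so $\mathrm{GL}(n).\mu$ is the isomorphism class of $\mu$; the action descends to $\mathbb{P}V_n$. Fix a Hermitian inner product on $\mathbb{C}^n$; it induces the Hermitian inner product $\langle\mu,\lambda\rangle=\sum_{i,j,k}\langle\mu(X_i,X_j),X_k\rangle\overline{\langle\lambda(X_i,X_j),X_k\rangle}$ on $V_n$, where $\{X_i\}$ is any orthonormal basis of $\mathbb{C}^n$. On $\mathfrak{gl}(n)$ put $(A,B)=\operatorname{tr}AB^*$, where $^*$ is the conjugate transpose with respect to the fixed inner product; $\mathrm{i}\mathfrak{u}(n)$ is the space of Hermitian operators. The moment map $m:\mathbb{P}V_n\to\mathrm{i}\mathfrak{u}(n)$ is defined by $(m([\mu]),A)=(\mathrm{d}\rho_\mu)_eA/\|\mu\|^2$ for $A\in\mathrm{i}\mathfrak{u}(n)$, where $\rho_\mu(g)=\langle g.\mu,g.\mu\rangle$, and $F_n([\mu])=\|m([\mu])\|^2=(m([\mu]),m([\mu]))$.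 Explicitly $m([\mu])=\mathrm{M}_\mu/\|\mu\|^2$, where, with $L^\mu_X(Y)=\mu(X,Y)$ and $R^\mu_X(Y)=\mu(Y,X)$, $\mathrm{M}_\mu=2\sum_iL^\mu_{X_i}(L^\mu_{X_i})^*-2\sum_i(L^\mu_{X_i})^*L^\mu_{X_i}-2\sum_i(R^\mu_{X_i})^*R^\mu_{X_i}$. A (left) Leibniz algebra is an algebra satisfying $x(yz)=(xy)z+y(xz)$ for all $x,y,z$. $L_n\subset\mathbb{P}V_n$ is the projectivization of the algebraic variety of all Leibniz algebra structures on $\mathbb{C}^n$. *)

(* Defs.v *)
From HB Require Import structures.
From mathcomp Require Import all_boot all_order all_algebra sesquilinear.
From mathcomp Require Import all_classical all_reals topology normedtype derive.
From mathcomp Require Import complex ring.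

Set Implicit Arguments.
Unset Strict Implicit.
Unset Printing Implicit Defensive.

Import Order.TTheory GRing.Theory Num.Theory.
Import numFieldNormedType.Exports.

Local Open Scope classical_set_scope.
Local Open Scope ring_scope.

Notation bilin R n :=
  {bilinear 'cV[R[i]]_n -> 'cV[R[i]]_n -> 'cV[R[i]]_n}.

(* Linear in the first argument, conjugate-linear in the second. *)
Notation herm_prod R n := {dot 'cV[R[i]]_n for (@Num.conj R[i])}.

Section Algebras.
Variables (R : realType) (n : nat).
Local Notation C := R[i].
Local Notation V := 'cV[C]_n.
Implicit Types mu lam : V -> V -> V.

Definition nonzero mu := exists x y, mu x y != 0.

Definition gl_act (g : 'M[C]_n) mu : V -> V -> V :=
  fun x y => g *m mu (invmx g *m x) (invmx g *m y).

(* A point of PV_n is represented by a nonzero element of V_n, so [lam] lies in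
   GL(n).[mu] when lam is a nonzero multiple of some g.mu. *)
Definition in_gl_orbit mu lam :=
  exists g : 'M[C]_n, exists c : C,
    [/\ g \in unitmx, c != 0 & forall x y, lam x y = c *: gl_act g mu x y].

Definition leibniz mu :=
  forall x y z, mu x (mu y z) = mu (mu x y) z + mu y (mu x z).

Definition lie_algebra mu :=
  (forall x, mu x x = 0) /\
  (forall x y z, mu x (mu y z) + mu y (mu z x) + mu z (mu x y) = 0).

Definition ideal mu (U : {vspace V}) :=
  forall x y, y \in U -> (mu x y \in U) /\ (mu y x \in U).

(* By bilinearity, brackets of basis vectors span all of [U, U]. *)
Definition derived mu (U : {vspace V}) : {vspace V} :=
  <<[seq mu x y | x <- vbasis U, y <- vbasis U]>>%VS.

Definition solvable mu (U : {vspace V}) :=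
  exists k, iter k (derived mu) U = 0%VS.

Definition semisimple_lie mu :=
  lie_algebra mu /\ forall U, ideal mu U -> solvable mu U -> U = 0%VS.

Section MomentMap.
Variables (dot : herm_prod R n) (X : 'I_n -> V).

Definition orthonormal_basis := forall i j, dot (X i) (X j) = (i == j)%:R.

(* Independent of the orthonormal basis X of the fixed inner product. *)
Definition ipV mu lam : C :=
  \sum_i \sum_j \sum_k dot (mu (X i) (X j)) (X k) *
                       (dot (lam (X i) (X j)) (X k))^*.

(* The conjugate transpose with respect to [dot]; see [adjointP]. *)
Definition adjoint (A : 'M[C]_n) : 'M[C]_n :=
  xget 0 [set B | forall x y, dot (A *m x) y = dot x (B *m y)].

Definition hermitian_op (A : 'M[C]_n) := adjoint A = A.

Definition ip_gl (A B : 'M[C]_n) : C := \tr (A *m adjoint B).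

Definition sqnorm mu : R := complex.Re (ipV mu mu).

Definition rho mu (g : 'M[C]_n) : R := sqnorm (gl_act g mu).

(* The differential of rho_mu at the identity in the direction A, computed along
   the curve 1 + t A, which stays in the open subset GL(n) for small t. *)
Definition drho mu (A : 'M[C]_n) : R :=
  derive1 (fun t : R => rho mu (1%:M + real_complex R t *: A)) 0.

(* m([mu]) is the Hermitian operator representing A |-> (d rho_mu)_e A / |mu|^2;
   it exists and is unique: see [moment_spec] and [momentE]. *)
Definition moment mu : 'M[C]_n :=
  xget 0 [set H | hermitian_op H /\ forall A, hermitian_op A ->
                    ip_gl H A = real_complex R (drho mu A / sqnorm mu)].

Definition Fn mu : R := complex.Re (ip_gl (moment mu) (moment mu)).

Definition Fn_minimal (lam : bilin R n) :=
  [/\ nonzero lam, leibniz lam &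
      forall nu : bilin R n, nonzero nu -> leibniz nu -> Fn lam <= Fn nu].

End MomentMap.
End Algebras.

Section Thy.
Variables (R : realType) (n : nat).
Local Notation C := R[i].
Local Notation V := 'cV[C]_n.
Variables (dot : herm_prod R n) (X : 'I_n -> V).
Hypothesis hX : orthonormal_basis dot X.

Lemma dotC x y : dot x y = (dot y x)^*.
Proof. by rewrite hermitian_subproof expr0 mul1r. Qed.

Lemma dot_suml I r (P : pred I) (F : I -> V) y :
  dot (\sum_(i <- r | P i) F i) y = \sum_(i <- r | P i) dot (F i) y.
Proof. exact: linear_sumlz. Qed.

Lemma dot_sumr I r (P : pred I) (F : I -> V) y :
  dot y (\sum_(i <- r | P i) F i) = \sum_(i <- r | P i) dot y (F i).
Proof. exact: linear_sumr. Qed.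

Lemma dotZl a x y : dot (a *: x) y = a * dot x y.
Proof. exact: linearZl_LR. Qed.

Lemma dotZr a x y : dot x (a *: y) = a^* * dot x y.
Proof. exact: linearZr_LR. Qed.

Lemma dotBl x y z : dot (x - y) z = dot x z - dot y z.
Proof. exact: linearBl. Qed.

Lemma dotBr x y z : dot z (x - y) = dot z x - dot z y.
Proof. exact: linearBr. Qed.

Let P : 'M[C]_n := \matrix_(i, k) X k i 0.
Let Q : 'M[C]_n := \matrix_(k, j) dot (delta_mx j 0) (X k).

Let PE y : P *m y = \sum_k y k 0 *: X k.
Proof.
apply/colP => i; rewrite mxE summxE; apply: eq_bigr => k _.
by rewrite !mxE mulrC.
Qed.

Lemma cV_sum (y : V) : y = \sum_j y j 0 *: delta_mx j 0.
Proof.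
rewrite {1}[y]matrix_sum_delta; apply: eq_bigr => i _.
by rewrite big_ord1.
Qed.

Let QE y k : (Q *m y) k 0 = dot y (X k).
Proof.
rewrite mxE {2}[y]cV_sum dot_suml; apply: eq_bigr => j _.
by rewrite dotZl mxE mulrC.
Qed.

Let QP : Q *m P = 1%:M.
Proof.
apply/matrixP => k l; rewrite mxE.
have -> : \sum_j Q k j * P j l = (Q *m X l) k 0.
  by rewrite mxE; apply: eq_bigr => j _; rewrite !mxE.
by rewrite QE hX mxE eq_sym.
Qed.

Lemma onb_expand (y : V) : y = \sum_k dot y (X k) *: X k.
Proof.
rewrite -{1}[y]mul1mx -(mulmx1C QP) -mulmxA PE.
by apply: eq_bigr => k _; rewrite QE.
Qed.

Lemma parseval (u v : V) : \sum_k dot u (X k) * (dot v (X k))^* = dot u v.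
Proof.
rewrite [in RHS](onb_expand v) dot_sumr; apply: eq_bigr => k _.
by rewrite dotZr mulrC.
Qed.

Lemma tr_onb (A : 'M[C]_n) : \tr A = \sum_k dot (A *m X k) (X k).
Proof.
rewrite -[A in LHS]mulmx1 -(mulmx1C QP) mulmxA mxtrace_mulC.
apply: eq_bigr => k _.
rewrite -QE !mxE; apply: eq_bigr => j _; congr (_ * _).
by rewrite !mxE; apply: eq_bigr => i _; rewrite !mxE.
Qed.

Lemma dot_eq0 (x : V) : (forall y, dot y x = 0) -> x = 0.
Proof.
move=> h; apply/eqP/negPn/negP => /(neq0_dnorm_gt0 (s := dot)).
by rewrite h ltxx.
Qed.

Lemma mulmx_inj (A B : 'M[C]_n) : (forall y : V, A *m y = B *m y) -> A = B.
Proof.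
move=> h; apply/matrixP => i j.
have := congr1 (fun M : V => M i 0) (h (delta_mx j 0)).
by rewrite -!colE !mxE.
Qed.

Lemma adjoint_unique (A B : 'M[C]_n) :
  (forall x y, dot (A *m x) y = dot x (B *m y)) -> adjoint dot A = B.
Proof.
move=> h; apply: xget_unique => // B' h'; apply: mulmx_inj => y.
apply/eqP; rewrite -subr_eq0; apply/eqP/dot_eq0 => x.
by rewrite dotBr -h -h' subrr.
Qed.

Lemma adjointP (A : 'M[C]_n) x y : dot (A *m x) y = dot x (adjoint dot A *m y).
Proof.
pose B : 'M[C]_n := P *m \matrix_(k, j) dot (delta_mx j 0) (A *m X k).
have BE (z : V) : B *m z = \sum_k dot z (A *m X k) *: X k.
  rewrite -mulmxA PE; apply: eq_bigr => k _; congr (_ *: _).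
  rewrite mxE [in RHS](cV_sum z) dot_suml; apply: eq_bigr => j _.
  by rewrite dotZl mxE mulrC.
have hB x' y' : dot (A *m x') y' = dot x' (B *m y').
  rewrite BE dot_sumr [in LHS](onb_expand x') mulmx_sumr dot_suml.
  apply: eq_bigr => k _.
  by rewrite dotZr -dotC -scalemxAr dotZl mulrC.
rewrite (adjoint_unique hB); exact: hB.
Qed.

Lemma adjointK (A : 'M[C]_n) : adjoint dot (adjoint dot A) = A.
Proof. by apply: adjoint_unique => x y; rewrite dotC -adjointP -dotC. Qed.

Lemma adjointM (A B : 'M[C]_n) :
  adjoint dot (A *m B) = adjoint dot B *m adjoint dot A.
Proof. by apply: adjoint_unique => x y; rewrite -!mulmxA -!adjointP. Qed.

Lemma adjointB (A B : 'M[C]_n) :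
  adjoint dot (A - B) = adjoint dot A - adjoint dot B.
Proof.
by apply: adjoint_unique => x y;
  rewrite !mulmxBl dotBl dotBr -!adjointP.
Qed.

Lemma adjoint_sum I r (S : pred I) (F : I -> 'M[C]_n) :
  adjoint dot (\sum_(i <- r | S i) F i) = \sum_(i <- r | S i) adjoint dot (F i).
Proof.
apply: adjoint_unique => x y.
rewrite !mulmx_suml dot_suml dot_sumr.
by apply: eq_bigr => i _; rewrite adjointP.
Qed.

Lemma adjointZ c (A : 'M[C]_n) : adjoint dot (c *: A) = c^* *: adjoint dot A.
Proof.
by apply: adjoint_unique => x y; rewrite -!scalemxAl dotZl dotZr conjCK adjointP.
Qed.

Lemma tr_adjoint (A : 'M[C]_n) : \tr (adjoint dot A) = (\tr A)^*.
Proof.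
rewrite !tr_onb rmorph_sum; apply: eq_bigr => k _.
by rewrite dotC -adjointP.
Qed.

Lemma ip_gl_eq0 (A : 'M[C]_n) : ip_gl dot A A = 0 -> A = 0.
Proof.
rewrite /ip_gl mxtrace_mulC tr_onb => /eqP.
under eq_bigr do rewrite -mulmxA dotC -adjointP -dotC.
have ge0 (x : V) : 0 <= dot x x.
  have [->|/(neq0_dnorm_gt0 (s := dot))/ltW//] := eqVneq x 0.
  by rewrite linear0l.
rewrite psumr_eq0 // => /allP h.
apply: mulmx_inj => y; rewrite mul0mx [y]onb_expand mulmx_sumr big1 // => k _.
rewrite -scalemxAr.
suff -> : A *m X k = 0 by rewrite scaler0.
apply/eqP/negPn/negP => /(neq0_dnorm_gt0 (s := dot)).
by rewrite (eqP (h k _)) ?ltxx // mem_index_enum.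
Qed.


Definition bnd (r : R -> C) :=
  exists K : C, \forall t \near (0 : R), `|r t| <= K.

(* F t = a + t b + O(t^2) as the real parameter t tends to 0. *)
Definition expa (F : R -> C) (a b : C) :=
  exists2 r, bnd r &
    \forall t \near (0 : R),
      F t = a + real_complex R t * b + real_complex R t ^+ 2 * r t.

Lemma bndD r s : bnd r -> bnd s -> bnd (fun t => r t + s t).
Proof.
move=> [K hK] [L hL]; exists (K + L); near=> t.
by rewrite (le_trans (ler_normD _ _)) // lerD //; near: t.
Unshelve. all: by end_near. Qed.

Lemma bndM r s : bnd r -> bnd s -> bnd (fun t => r t * s t).
Proof.
move=> [K hK] [L hL]; exists (K * L); near=> t.
by rewrite normrM ler_pM //; near: t.
Unshelve. all: by end_near. Qed.

Lemma bnd_cst c : bnd (fun=> c).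
Proof. by exists `|c|; near=> t. Unshelve. all: by end_near. Qed.

Lemma bnd_conj r : bnd r -> bnd (fun t => (r t)^*).
Proof.
by move=> [K hK]; exists K; near=> t; rewrite norm_conjC; near: t.
Unshelve. all: by end_near. Qed.

Lemma near0_lt (e : R) : 0 < e -> \forall t \near (0 : R), `|t| < e.
Proof.
move=> e0; have := @nbhsx_ballx R R 0 e e0.
by apply: filterS => t; rewrite -ball_normE /= sub0r normrN.
Qed.

Lemma bnd_t : bnd (fun t => real_complex R t).
Proof.
exists (real_complex R 1); near=> t.
rewrite normc_def /= expr0n addr0 sqrtr_sqr lecR; near: t.
by near=> t; apply: ltW; near: t; apply: near0_lt.
Unshelve. all: by end_near. Qed.

Lemma expa_cst c : expa (fun=> c) c 0.
Proof.
exists (fun=> 0); first exact: bnd_cst.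
by near=> t; rewrite !mulr0 !addr0.
Unshelve. all: by end_near. Qed.

Lemma expaD F G a b c d : expa F a b -> expa G c d ->
  expa (fun t => F t + G t) (a + c) (b + d).
Proof.
move=> [r br hr] [s bs hs]; exists (fun t => r t + s t); first exact: bndD.
near=> t.
have -> : F t = a + real_complex R t * b + real_complex R t ^+ 2 * r t by near: t.
have -> : G t = c + real_complex R t * d + real_complex R t ^+ 2 * s t by near: t.
ring.
Unshelve. all: by end_near. Qed.

Lemma expaM F G a b c d : expa F a b -> expa G c d ->
  expa (fun t => F t * G t) (a * c) (a * d + b * c).
Proof.
move=> [r br hr] [s bs hs].
exists (fun t => b * d + (a + real_complex R t * b) * s t
         + r t * (c + real_complex R t * d)
         + real_complex R t * real_complex R t * (r t * s t)).
  by do !(apply: bndD || apply: bndM || apply: bnd_cst || apply: bnd_t).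
near=> t.
have -> : F t = a + real_complex R t * b + real_complex R t ^+ 2 * r t by near: t.
have -> : G t = c + real_complex R t * d + real_complex R t ^+ 2 * s t by near: t.
ring.
Unshelve. all: by end_near. Qed.

Lemma expa_conj F a b : expa F a b -> expa (fun t => (F t)^*) a^* b^*.
Proof.
move=> [r br hr]; exists (fun t => (r t)^*); first exact: bnd_conj.
near=> t.
have -> : F t = a + real_complex R t * b + real_complex R t ^+ 2 * r t by near: t.
rewrite !(rmorphD, rmorphM, rmorphXn) /=.
have -> // : (real_complex R t)^* = real_complex R t.
exact: conjc_real.
Unshelve. all: by end_near. Qed.

Lemma expa_ext F G a b : (forall t, F t = G t) -> expa F a b -> expa G a b.
Proof. by move=> FG [r br hr]; exists r => //; near=> t; rewrite -FG; near: t.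
Unshelve. all: by end_near. Qed.

Lemma expa_sum (I : finType) (F : I -> R -> C) (a b : I -> C) :
  (forall i, expa (F i) (a i) (b i)) ->
  expa (fun t => \sum_i F i t) (\sum_i a i) (\sum_i b i).
Proof.
move=> h.
elim: (index_enum I) => [|i s IH].
  rewrite !big_nil; apply: expa_ext (expa_cst 0) => t.
  by rewrite big_nil.
rewrite !big_cons; apply: expa_ext (expaD (h i) IH) => t.
by rewrite big_cons.
Qed.

Definition expam m p (F : R -> 'M[C]_(m, p)) (A B : 'M[C]_(m, p)) :=
  forall i j, expa (fun t => F t i j) (A i j) (B i j).

Lemma expam_mul m p q (F : R -> 'M[C]_(m, p)) (G : R -> 'M[C]_(p, q)) A B A' B' :
  expam F A B -> expam G A' B' ->
  expam (fun t => F t *m G t) (A *m A') (A *m B' + B *m A').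
Proof.
move=> hF hG i j; rewrite !mxE -big_split /=.
apply: expa_ext (expa_sum (fun k => expaM (hF i k) (hG k j))) => t.
by rewrite mxE.
Qed.

Lemma expam_cst m p (A : 'M[C]_(m, p)) : expam (fun=> A) A 0.
Proof. by move=> i j; rewrite mxE; exact: expa_cst. Qed.

Lemma expam_lin A : expam (fun t => 1%:M + real_complex R t *: A) 1%:M (A : 'M[C]_n).
Proof.
move=> i j; exists (fun=> 0); first exact: bnd_cst.
by near=> t; rewrite !mxE mulr0 addr0.
Unshelve. all: by end_near. Qed.

Lemma mu_expand (mu : bilin R n) (u v : V) :
  mu u v = \sum_i \sum_j (u i 0 * v j 0) *: mu (delta_mx i 0) (delta_mx j 0).
Proof.
rewrite {1}(cV_sum u) linear_sumlz; apply: eq_bigr => i _.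
rewrite linearZl_LR {1}(cV_sum v) linear_sumr scaler_sumr.
by apply: eq_bigr => j _; rewrite linearZr_LR scalerA.
Qed.

Lemma expam_mu (mu : bilin R n) (u v : R -> V) a b c d :
  expam u a b -> expam v c d ->
  expam (fun t => mu (u t) (v t)) (mu a c) (mu a d + mu b c).
Proof.
move=> hu hv k l; rewrite (ord1 l) {l}.
rewrite [in mu a c]mu_expand [in mu a d]mu_expand [in mu b c]mu_expand.
rewrite mxE !summxE -big_split /=.
apply: (@expa_ext
 (fun t => \sum_i \sum_j u t i 0 * v t j 0 * mu (delta_mx i 0) (delta_mx j 0) k 0)).
  move=> t; rewrite [in RHS]mu_expand summxE; apply: eq_bigr => i _.
  by rewrite summxE; apply: eq_bigr => j _; rewrite mxE.
apply: expa_sum => i; rewrite !summxE -big_split /=.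
apply: expa_sum => j; rewrite !mxE.
have := expaM (expaM (hu i 0) (hv j 0))
  (expa_cst (mu (delta_mx i 0) (delta_mx j 0) k 0)).
by rewrite mulr0 add0r mulrDl.
Qed.

Lemma expa_dot (u : R -> V) a b x : expam u a b ->
  expa (fun t => dot (u t) x) (dot a x) (dot b x).
Proof.
move=> hu; rewrite [in dot a x](cV_sum a) [in dot b x](cV_sum b) !dot_suml.
apply: (@expa_ext (fun t => \sum_j dot (u t j 0 *: delta_mx j 0) x)).
  by move=> t; rewrite [in RHS](cV_sum (u t)) dot_suml.
apply: expa_sum => j; rewrite !dotZl.
apply: (@expa_ext (fun t => u t j 0 * dot (delta_mx j 0) x)).
  by move=> t; rewrite dotZl.
have := expaM (hu j 0) (expa_cst (dot (delta_mx j 0) x)).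
by rewrite mulr0 add0r.
Qed.

Definition mxs m p (A : 'M[C]_(m, p)) : C := \sum_i \sum_j `|A i j|.

Lemma mxs_ge m p (A : 'M[C]_(m, p)) i j : `|A i j| <= mxs A.
Proof.
rewrite /mxs (bigD1 i) //= (bigD1 j) //= -addrA lerDl addr_ge0 ?sumr_ge0 //.
by move=> k _; rewrite sumr_ge0.
Qed.

Lemma mxs_ge0 m p (A : 'M[C]_(m, p)) : 0 <= mxs A.
Proof. by rewrite sumr_ge0 // => i _; rewrite sumr_ge0. Qed.

Lemma mxsD m p (A B : 'M[C]_(m, p)) : mxs (A + B) <= mxs A + mxs B.
Proof.
rewrite -big_split ler_sum // => i _ /=; rewrite -big_split ler_sum // => j _ /=.
by rewrite mxE ler_normD.
Qed.

Lemma mxsZ m p c (A : 'M[C]_(m, p)) : mxs (c *: A) = `|c| * mxs A.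
Proof.
rewrite mulr_sumr; apply: eq_bigr => i _; rewrite mulr_sumr.
by apply: eq_bigr => j _; rewrite mxE normrM.
Qed.

Lemma mxsM m p q (A : 'M[C]_(m, p)) (B : 'M[C]_(p, q)) :
  mxs (A *m B) <= mxs A * mxs B.
Proof.
rewrite /mxs mulr_suml ler_sum // => i _; rewrite mulr_suml.
apply: (@le_trans _ _ (\sum_j \sum_k `|A i k| * `|B k j|)).
  apply: ler_sum => j _; rewrite mxE (le_trans (ler_norm_sum _ _ _)) //.
  by apply: ler_sum => k _; rewrite normrM.
rewrite exchange_big /=; apply: ler_sum => k _; rewrite -mulr_sumr ler_wpM2l //.
rewrite [leRHS](bigD1 k) //= lerDl sumr_ge0 // => l _.
by rewrite sumr_ge0.
Qed.

Lemma near_mxs (A : 'M[C]_n) :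
  \forall t \near (0 : R), `|real_complex R t| * mxs A <= 2^-1.
Proof.
have [a a0 ha] : exists2 a : R, 0 <= a & mxs A = real_complex R a.
  have := mxs_ge0 A; case: (mxs A) => x y; rewrite lecE /= => /andP[/eqP h x0].
  by exists x => //; rewrite h.
have a1 : 0 < a + 1 by rewrite ltr_wpDl.
have d0 : 0 < 2^-1 / (a + 1) by rewrite divr_gt0 // invr_gt0 ltr0n.
near=> t; rewrite ha normc_def /= expr0n addr0 sqrtr_sqr.
have -> : (2^-1 : C) = real_complex R 2^-1 by rewrite fmorphV rmorphMn.
rewrite -rmorphM lecR /=.
have : `|t| < 2^-1 / (a + 1) by near: t; apply: near0_lt.
rewrite ltr_pdivlMr // => /ltW; apply: le_trans.
by rewrite ler_wpM2l // lerDl.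
Unshelve. all: by end_near. Qed.

Lemma near_unit (A : 'M[C]_n) :
  \forall t \near (0 : R), 1%:M + real_complex R t *: A \in unitmx.
Proof.
near=> t.
have ht : `|real_complex R t| * mxs A <= 2^-1 by near: t; exact: near_mxs.
rewrite -row_free_unit; apply: inj_row_free => v.
rewrite mulmxDr mulmx1 -scalemxAr => /eqP; rewrite addr_eq0 => /eqP vE.
have : mxs v <= 2^-1 * mxs v.
  rewrite {1}vE -scaleNr mxsZ normrN.
  apply: le_trans (ler_wpM2r (mxs_ge0 v) ht).
  by rewrite -mulrA ler_wpM2l // mulrC mxsM.
move=> h; have v0 : mxs v = 0.
  apply/eqP; rewrite eq_le mxs_ge0 andbT.
  move: h; rewrite -subr_ge0 -[X in _ - X]mul1r -mulrBl.
  have -> : (2^-1 - 1 : C) = - 2^-1 by field.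
  by rewrite mulNr oppr_ge0 pmulr_rle0 // invr_gt0 ltr0n.
apply/matrixP => i j; rewrite mxE; apply/eqP; rewrite -normr_le0 -v0.
exact: mxs_ge.
Unshelve. all: by end_near. Qed.

Lemma expam_inv (A : 'M[C]_n) :
  expam (fun t => invmx (1%:M + real_complex R t *: A)) 1%:M (- A).
Proof.
pose B t := invmx (1%:M + real_complex R t *: A).
have BE : \forall t \near (0 : R), B t = 1%:M - real_complex R t *: (A *m B t).
  near=> t.
  have u : 1%:M + real_complex R t *: A \in unitmx by near: t; exact: near_unit.
  have := mulmxV u; rewrite -/(B t) mulmxDl mul1mx -scalemxAl => <-.
  by rewrite addrK.
move=> i j; exists (fun t => (A *m A *m B t) i j).
  exists (mxs (A *m A) * (mxs (1%:M : 'M[C]_n) *+ 2)); near=> t.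
  apply: le_trans (mxs_ge _ _ _) _; apply: le_trans (mxsM _ _) _.
  rewrite ler_wpM2l ?mxs_ge0 //.
  have ht : `|real_complex R t| * mxs A <= 2^-1 by near: t; exact: near_mxs.
  have e : B t = 1%:M - real_complex R t *: (A *m B t) by near: t.
  have : mxs (B t) <= mxs (1%:M : 'M[C]_n) + 2^-1 * mxs (B t).
    rewrite {1}e (le_trans (mxsD _ _)) // lerD2l -scaleNr mxsZ normrN.
    apply: le_trans (ler_wpM2r (mxs_ge0 _) ht).
    by rewrite -mulrA ler_wpM2l // mxsM.
  rewrite -lerBlDr -{1}[mxs (B t)]mul1r -mulrBl.
  have -> : (1 - 2^-1 : C) = 2^-1 by field.
  by rewrite mulrC ler_pdivrMr ?ltr0n // mulr_natr.
near=> t.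
have e : B t = 1%:M - real_complex R t *: (A *m B t) by near: t.
rewrite -/(B t) {1}e {1}e mulmxBr mulmx1 -scalemxAr mulmxA scalerBr scalerA opprB.
rewrite !mxE; ring.
Unshelve. all: by end_near. Qed.

Lemma expa_derive (F : R -> C) a b :
  expa F a b -> derive1 (fun t => complex.Re (F t)) 0 = complex.Re b.
Proof.
move=> [r [K hK] hr].
have ReZ (t : R) z : complex.Re (real_complex R t * z) = t * complex.Re z.
  by case: z => x y /=; rewrite mul0r subr0.
have FE : \forall t \near (0 : R), complex.Re (F t) =
    complex.Re a + t * complex.Re b + t ^+ 2 * complex.Re (r t).
  near=> t.
  have -> : F t = a + real_complex R t * b + real_complex R t ^+ 2 * r t by near: t.
  by rewrite !raddfD /= -rmorphXn !ReZ.
have F0 : complex.Re (F 0) = complex.Re a.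
  by rewrite (nbhs_singleton FE) expr0n /= !mul0r !addr0.
have [k hk] : exists k : R, \forall t \near (0 : R), `|complex.Re (r t)| <= k.
  exists (complex.Re K); near=> t.
  have : (real_complex R `|complex.Re (r t)|) <= K.
    by apply: le_trans (normc_ge_Re _) _; near: t.
  by case: (K) => x y; rewrite lecE /= => /andP[].
rewrite /derive1; apply: cvg_lim => //.
apply/cvgrPdist_le => /= e e0.
have k1 : 0 < `|k| + 1 by rewrite ltr_wpDl.
have d0 : 0 < e / (`|k| + 1) by rewrite divr_gt0.
near=> t.
have t0 : t != 0 by near: t; exact: nbhs_dnbhs_neq.
rewrite addr0 F0.
have -> : complex.Re (F t) =
    complex.Re a + t * complex.Re b + t ^+ 2 * complex.Re (r t).
  by near: t; apply: nbhs_dnbhs.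
have -> : complex.Re b - t^-1 *:
   (complex.Re a + t * complex.Re b + t ^+ 2 * complex.Re (r t) - complex.Re a)
   = - (t * complex.Re (r t)).
  by rewrite /GRing.scale /=; field.
rewrite normrN normrM.
have h1 : `|complex.Re (r t)| <= `|k| + 1.
  have : `|complex.Re (r t)| <= k by near: t; apply: nbhs_dnbhs.
  by move/le_trans; apply; rewrite (le_trans (ler_norm k)) // lerDl.
have h2 : `|t| <= e / (`|k| + 1).
  by apply: ltW; near: t; apply: nbhs_dnbhs; apply: near0_lt.
apply: le_trans (ler_pM _ _ h2 h1) _ => //.
by rewrite divfK // gt_eqF.
Unshelve. all: by end_near. Qed.


(* The operators L^mu_x and R^mu_x, and M_mu. *)
Definition lop (mu : V -> V -> V) x : 'M[C]_n := \matrix_(i, j) mu x (delta_mx j 0) i 0.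
Definition rop (mu : V -> V -> V) x : 'M[C]_n := \matrix_(i, j) mu (delta_mx j 0) x i 0.

Definition Mop (mu : V -> V -> V) : 'M[C]_n :=
  2 *: (\sum_i lop mu (X i) *m adjoint dot (lop mu (X i)))
  - 2 *: (\sum_i adjoint dot (lop mu (X i)) *m lop mu (X i))
  - 2 *: (\sum_i adjoint dot (rop mu (X i)) *m rop mu (X i)).

Lemma lopE (mu : bilin R n) x y : lop mu x *m y = mu x y.
Proof.
rewrite [in RHS](cV_sum y) linear_sumr; apply/colP => i; rewrite mxE summxE.
by apply: eq_bigr => j _; rewrite linearZr_LR !mxE mulrC.
Qed.

Lemma ropE (mu : bilin R n) x y : rop mu x *m y = mu y x.
Proof.
rewrite [in RHS](cV_sum y) linear_sumlz; apply/colP => i; rewrite mxE summxE.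
by apply: eq_bigr => j _; rewrite linearZl_LR !mxE mulrC.
Qed.

Lemma hermitian_Mop mu : hermitian_op dot (Mop mu).
Proof.
have h2 : (2 : C)^* = 2 by rewrite rmorph_nat.
have h (F G : 'I_n -> 'M[C]_n) : (forall i, adjoint dot (F i) = G i) ->
    adjoint dot (2 *: \sum_i F i) = 2 *: \sum_i G i.
  by move=> FG; rewrite adjointZ h2 adjoint_sum (eq_bigr _ (fun i _ => FG i)).
rewrite /hermitian_op /Mop 2!adjointB; congr (_ - _ - _); apply: h => i;
  by rewrite adjointM adjointK.
Qed.

Lemma ipVE (mu lam : V -> V -> V) :
  ipV dot X mu lam = \sum_i \sum_j dot (mu (X i) (X j)) (lam (X i) (X j)).
Proof. by apply: eq_bigr => i _; apply: eq_bigr => j _; rewrite parseval. Qed.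

Lemma ip_Mop (mu : bilin R n) A : hermitian_op dot A ->
  ip_gl dot (Mop mu) A =
  2 * \sum_i \sum_j dot (A *m mu (X i) (X j) - mu (X i) (A *m X j)
                         - mu (A *m X i) (X j)) (mu (X i) (X j)).
Proof.
rewrite /ip_gl /Mop => ->.
have lin3 (F1 F2 F3 : 'I_n -> 'M[C]_n) :
  \tr ((2 *: (\sum_i F1 i) - 2 *: (\sum_i F2 i) - 2 *: (\sum_i F3 i)) *m A) =
  2 * (\sum_i \tr (F1 i *m A) - \sum_i \tr (F2 i *m A) - \sum_i \tr (F3 i *m A)).
  rewrite -!scalerBr -scalemxAl mxtraceZ 2!mulmxBl !mulmx_suml.
  by rewrite (raddfB (@mxtrace C n)) (raddfB (@mxtrace C n)) !(raddf_sum (@mxtrace C n)).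
rewrite lin3; congr (_ * _).
have -> : \sum_i \tr (adjoint dot (rop mu (X i)) *m rop mu (X i) *m A) =
    \sum_i \sum_j dot (mu (A *m X i) (X j)) (mu (X i) (X j)).
  rewrite [in RHS]exchange_big; apply: eq_bigr => j _.
  rewrite tr_onb; apply: eq_bigr => i _.
  by rewrite -!mulmxA dotC -adjointP -dotC !ropE.
rewrite -!sumrB; apply: eq_bigr => i _.
rewrite -mulmxA mxtrace_mulC !tr_onb -!sumrB; apply: eq_bigr => j _.
rewrite !dotBl -!mulmxA; congr (_ - _ - _).
  by rewrite dotC -adjointP -dotC !lopE.
by rewrite dotC -adjointP -dotC !lopE.
Qed.

Lemma ip_herm_real H A : hermitian_op dot H -> hermitian_op dot A ->
  (ip_gl dot H A)^* = ip_gl dot H A.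
Proof.
by rewrite /ip_gl => hH hA; rewrite -tr_adjoint adjointM adjointK hH hA mxtrace_mulC.
Qed.

Lemma realE (z : C) : z^* = z -> z = real_complex R (complex.Re z).
Proof.
by move=> /CrealP; rewrite -[z \is Num.real]/(z \is Num.real) => /RRe_real.
Qed.

Lemma drhoE (mu : bilin R n) A : hermitian_op dot A ->
  real_complex R (drho dot X mu A) = ip_gl dot (Mop mu) A.
Proof.
move=> hA; rewrite [RHS]realE; last exact/ip_herm_real/hA/hermitian_Mop.
congr real_complex_def; rewrite ip_Mop //.
pose G t : 'M[C]_n := 1%:M + real_complex R t *: A.
pose w i j := A *m mu (X i) (X j) - mu (X i) (A *m X j) - mu (A *m X i) (X j).
have hw i j : expam (fun t => gl_act (G t) mu (X i) (X j)) (mu (X i) (X j)) (w i j).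
  have hB k : expam (fun t => invmx (G t) *m X k) (X k) (- (A *m X k)).
    have := expam_mul (expam_inv A) (expam_cst (X k)).
    by rewrite mul1mx mulmx0 add0r mulNmx.
  have := expam_mul (expam_lin A) (expam_mu mu (hB i) (hB j)).
  rewrite !mul1mx linearNr linearNl.
  have -> // : - mu (X i) (A *m X j) - mu (A *m X i) (X j) + A *m mu (X i) (X j) = w i j.
  by rewrite /w addrC addrA.
have := expa_derive (expa_sum (fun i => expa_sum (fun j => expa_sum (fun k =>
  expaM (expa_dot (X k) (hw i j)) (expa_conj (expa_dot (X k) (hw i j))))))).
rewrite /drho /rho /sqnorm /ipV => ->.
rewrite mulr_sumr !raddf_sum /=; apply: eq_bigr => i _.
rewrite mulr_sumr !raddf_sum /=; apply: eq_bigr => j _.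
rewrite big_split /= !parseval -/(w i j) [X in X + _]dotC raddfD mulr_natl mulr2n /=.
by rewrite raddfD /=; case: (dot _ _).
Qed.

Lemma sqnorm_neq0 (mu : bilin R n) : nonzero mu -> ipV dot X mu mu != 0.
Proof.
move=> [x [y xy]]; apply: contra xy; rewrite ipVE => h.
have ge0 (z : V) : 0 <= dot z z.
  have [->|/(neq0_dnorm_gt0 (s := dot))/ltW//] := eqVneq z 0.
  by rewrite linear0l.
have hij i j : mu (X i) (X j) = 0.
  move: h; rewrite psumr_eq0 => [/allP/(_ i)|k _]; last by rewrite sumr_ge0.
  rewrite mem_index_enum psumr_eq0 // => /(_ isT)/allP/(_ j).
  rewrite mem_index_enum => /(_ isT)/= h.
  apply/eqP/negPn/negP => /(neq0_dnorm_gt0 (s := dot)).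
  by rewrite (eqP h) ltxx.
rewrite (onb_expand x) (onb_expand y) linear_sumlz big1 // => i _.
rewrite linear_sumr big1 // => j _.
by rewrite linearZr_LR linearZl_LR hij !scaler0.
Qed.

Lemma sqnormE (mu : V -> V -> V) : real_complex R (sqnorm dot X mu) = ipV dot X mu mu.
Proof.
rewrite -realE // ipVE rmorph_sum; apply: eq_bigr => i _.
by rewrite rmorph_sum; apply: eq_bigr => j _; rewrite /= -dotC.
Qed.

(* The linear functional defining the moment map is represented by a Hermitian
   operator, so the choice made in [moment] is never the default value. *)
Lemma moment_spec (mu : bilin R n) (H := (ipV dot X mu mu)^-1 *: Mop mu) :
  hermitian_op dot H /\ forall A, hermitian_op dot A ->
    ip_gl dot H A = real_complex R (drho dot X mu A / sqnorm dot X mu).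
Proof.
split.
  rewrite /hermitian_op adjointZ hermitian_Mop.
  congr (_ *: _); rewrite -sqnormE -fmorphV; exact: conjc_real.
move=> A hA; rewrite rmorphM /= drhoE // /H /ip_gl -scalemxAl mxtraceZ mulrC.
by congr (_ * _); rewrite -sqnormE -fmorphV.
Qed.

(* The explicit formula m([mu]) = M_mu / ||mu||^2. *)
Lemma momentE (mu : bilin R n) :
  moment dot X mu = (ipV dot X mu mu)^-1 *: Mop mu.
Proof.
have [hH hE] := moment_spec mu.
apply: xget_unique => // H [hH' hE'].
apply/eqP; rewrite -subr_eq0; apply/eqP/ip_gl_eq0.
set D := _ - _.
have hD : hermitian_op dot D by rewrite /hermitian_op adjointB hH hH'.
by rewrite {1}/D /ip_gl mulmxBl raddfB /= -/(ip_gl _ _ D) hE' // -hE // subrr.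
Qed.

Lemma MopZ (mu lam : V -> V -> V) c : (forall x y, lam x y = c *: mu x y) ->
  Mop lam = (c * c^*) *: Mop mu.
Proof.
move=> h.
have lE x : lop lam x = c *: lop mu x by apply/matrixP => i j; rewrite !mxE h mxE.
have rE x : rop lam x = c *: rop mu x by apply/matrixP => i j; rewrite !mxE h mxE.
have hs (F G : 'I_n -> 'M[C]_n) : (forall i, F i = (c * c^*) *: G i) ->
    2 *: \sum_i F i = (c * c^*) *: (2 *: \sum_i G i).
  move=> FG; rewrite (eq_bigr _ (fun i _ => FG i)) -scaler_sumr !scalerA.
  by rewrite [2 * _]mulrC.
rewrite /Mop 2![in RHS]scalerBr; congr (_ - _ - _); apply: hs => i;
  by rewrite ?lE ?rE adjointZ -scalemxAl -scalemxAr scalerA // [c^* * _]mulrC.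
Qed.

(* Fn depends only on the point [mu] of PV_n. *)
Lemma FnZ (mu lam : bilin R n) c : c != 0 ->
  (forall x y, lam x y = c *: mu x y) -> Fn dot X lam = Fn dot X mu.
Proof.
move=> c0 h; congr (complex.Re (ip_gl dot _ _)).
all: rewrite !momentE (MopZ h).
all: have -> : ipV dot X lam lam = c * c^* * ipV dot X mu mu by
  rewrite !ipVE mulr_sumr; apply: eq_bigr => i _; rewrite mulr_sumr;
  apply: eq_bigr => j _; rewrite h dotZl dotZr mulrA.
all: rewrite scalerA invfM mulrAC mulVf ?mul1r // mulf_neq0 //.
all: by rewrite conjC_eq0.
Qed.

End Thy.

(* Main.v *)
(* For a nonzero [mu] the moment map has trace -2, so Cauchy-Schwarz gives
   [F_n >= 4/n], with equality exactly when the moment map is scalar.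

   If the moment map at [mu] is a nonzero scalar, the adjoint of a derivation is
   a derivation, because [|D*.mu|^2 = <[D, D*].mu, mu>] is a multiple of
   [tr [D, D*]].  For a Leibniz algebra the orthogonal projector onto the kernel
   of [x |-> L_x] is then itself a derivation, so its trace is 0 and the algebra
   is Lie with trivial centre.  All derivations are inner, hence the orthogonal
   complement of an ideal is an ideal, and abelian ideals vanish.

   Conversely, on a minimal ideal of a semisimple Lie algebra one minimises
   [|P.nu|^2 + t |P|^2] over [det P = 1] and lets [t] tend to 0.  The first-order
   condition bounds [|P* P D x|] by [|P D| |P x|] for every derivation [D], so the
   kernel of a limit of the normalised minimisers [P / |P|] is invariant under
   the derivations, that is, an ideal; by minimality it is 0, the minimisers stay
   bounded, and their limit is a critical point, at which the derivations are
   closed under adjoints.  Minimal ideals have complementary ideals (all their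
   derivations are inner), so induction yields a conjugate-linear star operation
   on the whole algebra; orthonormalising the form [tr (ad x (ad y)^star)] produces a
   point of the orbit whose moment map is scalar, and the minimum 4/n is attained. *)

Require Import Defs.
From HB Require Import structures.
From mathcomp Require Import all_boot all_order all_algebra sesquilinear.
From mathcomp Require Import all_classical all_reals complex.
From mathcomp Require Import topology normedtype sequences ring.

Set Implicit Arguments.
Unset Strict Implicit.
Unset Printing Implicit Defensive.

Import Order.TTheory GRing.Theory Num.Theory.
Import numFieldNormedType.Exports.

Local Open Scope ring_scope.

(** * Bilinear maps, the infinitesimal action of gl(n), and derivations *)

Section BilinearMaps.
Variable R : realType.
Local Notation C := R[i].

(** Two dimensions are allowed so that one construction covers both the action of an invertible [g]
    (take [A = g], [B = invmx g]) and the restriction of an algebra to an ideal in coordinates. *)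
Definition pushpull n p (A : 'M[C]_(p, n)) (B : 'M[C]_(n, p)) (mu : bilin R n) :
  'cV[C]_p -> 'cV[C]_p -> 'cV[C]_p := fun x y => A *m mu (B *m x) (B *m y).

Fact pushpull_bilinear n p A B mu :
  bilinear_for *:%R *:%R (@pushpull n p A B mu).
Proof.
split=> [x a u v|y a u v]; rewrite /pushpull mulmxDr -scalemxAr.
  by rewrite linearDl linearZl_LR mulmxDr -scalemxAr.
by rewrite linearDr linearZr_LR mulmxDr -scalemxAr.
Qed.

HB.instance Definition _ n p A B mu :=
  bilinear_isBilinear.Build C _ _ _ _ _ (@pushpull n p A B mu)
    (pushpull_bilinear A B mu).

Definition gl_bilin n (g : 'M[C]_n) (mu : bilin R n) : bilin R n :=
  pushpull g (invmx g) mu.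

Lemma gl_bilinE n (g : 'M[C]_n) (mu : bilin R n) x y :
  gl_bilin g mu x y = gl_act g mu x y.
Proof. by []. Qed.

Lemma mxtraceB n (A B : 'M[C]_n) : \tr (A - B) = \tr A - \tr B.
Proof. exact: raddfB. Qed.

Variable n : nat.
Local Notation V := 'cV[C]_n.
Implicit Types (mu : bilin R n) (D E : 'M[C]_n).

(* The infinitesimal action of [gl(n)] on bilinear maps. *)
Definition act E mu : V -> V -> V :=
  fun x y => E *m mu x y - mu (E *m x) y - mu x (E *m y).

Lemma actE E mu x y :
  act E mu x y = E *m mu x y - mu (E *m x) y - mu x (E *m y).
Proof. by []. Qed.

Fact act_bilinear E mu : bilinear_for *:%R *:%R (act E mu).
Proof.
have aux (a : C) (p q r p' q' r' : V) : a *: p + p' - (a *: q + q') - (a *: r + r')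
    = a *: (p - q - r) + (p' - q' - r').
  by rewrite !scalerBr !opprD [X in X + _ = _]addrACA [LHS]addrACA.
split=> [x|y] a u v; rewrite /act.
  rewrite linearDl linearZl_LR !mulmxDr -!scalemxAr !(linearDl, linearZl_LR).
  exact: aux.
rewrite linearDr linearZr_LR !mulmxDr -!scalemxAr !(linearDr, linearZr_LR).
exact: aux.
Qed.

HB.instance Definition _ E mu :=
  bilinear_isBilinear.Build C _ _ _ _ _ (act E mu) (act_bilinear E mu).

Definition derivation D mu := forall x y, act D mu x y = 0.

Lemma derivationP D mu :
  derivation D mu <-> forall x y, D *m mu x y = mu (D *m x) y + mu x (D *m y).
Proof.
split=> h x y; last by rewrite /act h -addrA -opprD subrr.
by have := h x y; rewrite /act -addrA -opprD => /subr0_eq.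
Qed.

Lemma act_linear a D E mu x y :
  act (a *: D + E) mu x y = a *: act D mu x y + act E mu x y.
Proof.
have aux (p q r p' q' r' : V) : a *: p + p' - (a *: q + q') - (a *: r + r')
    = a *: (p - q - r) + (p' - q' - r').
  by rewrite !scalerBr !opprD [X in X + _ = _]addrACA [LHS]addrACA.
rewrite /act !mulmxDl -!scalemxAl linearDl linearZl_LR linearDr linearZr_LR.
exact: aux.
Qed.

Lemma actB D E mu x y : act (D - E) mu x y = act D mu x y - act E mu x y.
Proof. by rewrite addrC -scaleN1r act_linear scaleN1r addrC. Qed.

Lemma act_commutator D E mu x y :
  act (D *m E - E *m D) mu x y = act D (act E mu) x y - act E (act D mu) x y.
Proof.
have aux (DE ED e1 e2 f1 f2 m1 m2 m3 m4 p q r s : V) :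
    DE - m1 - m2 - (ED - m3 - m4)
    = DE - e1 - e2 - (f1 - m3 - p) - (f2 - q - m4)
      - (ED - f1 - f2 - (e1 - m1 - q) - (e2 - p - m2)).
  by apply/colP => i; rewrite !mxE; ring.
rewrite actB /act !mulmxBr -!mulmxA.
exact: aux.
Qed.

(** * Adjoints, the Hermitian product on V_n and the operator [Mop] *)

Section Hermitian.
Variables (dot : herm_prod R n) (X : 'I_n -> V).
Hypothesis hX : orthonormal_basis dot X.
Local Notation adj := (adjoint dot).

Lemma adjointP' (A : 'M[C]_n) x y : dot (adj A *m x) y = dot x (A *m y).
Proof. by rewrite (adjointP hX) (adjointK hX). Qed.

Lemma adjointN A : adj (- A) = - adj A.
Proof. by rewrite -[- A]scaleN1r (adjointZ hX) rmorphN1 scaleN1r. Qed.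

Lemma adjointD A B : adj (A + B) = adj A + adj B.
Proof. by rewrite -{1}[B]opprK (adjointB hX) adjointN opprK. Qed.

(** Both sides are the trace of [adj G *m F *m A], up to cyclic rotation. *)
Lemma sum_onb_adjoint (F G A : 'M[C]_n) :
  \sum_i dot (F *m (A *m X i)) (G *m X i) = \sum_i dot (F *m X i) (G *m (adj A *m X i)).
Proof.
transitivity (\tr (adj G *m F *m A)).
  by rewrite (tr_onb hX); apply: eq_bigr => i _; rewrite -!mulmxA adjointP'.
rewrite -mulmxA mxtrace_mulC -mulmxA mxtrace_mulC (tr_onb hX).
by apply: eq_bigr => i _; rewrite -!mulmxA (adjointP hX) adjointP'.
Qed.

Lemma ipV_act (mu nu : bilin R n) E :
  ipV dot X (act E mu) nu = ipV dot X mu (act (adj E) nu).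
Proof.
rewrite !(ipVE hX).
have dotB3 (a b c d : V) : (dot (a - b - c) d = dot a d - dot b d - dot c d) *
    (dot d (a - b - c) = dot d a - dot d b - dot d c).
  by rewrite !(dotBl dot) !(dotBr dot).
have sumB3 (f g h : 'I_n -> 'I_n -> C) :
    \sum_i \sum_j (f i j - g i j - h i j) =
    \sum_i \sum_j f i j - \sum_i \sum_j g i j - \sum_i \sum_j h i j.
  rewrite -!sumrB; apply: eq_bigr => i _; rewrite -!sumrB; exact: eq_bigr.
under eq_bigr do under eq_bigr do rewrite /act dotB3.
under [in RHS]eq_bigr do under eq_bigr do rewrite /act dotB3.
rewrite !sumB3; congr (_ - _ - _).
- by apply: eq_bigr => i _; apply: eq_bigr => j _; rewrite (adjointP hX).
- rewrite exchange_big [RHS]exchange_big; apply: eq_bigr => j _ /=.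
  transitivity (\sum_k dot (rop mu (X j) *m (E *m X k)) (rop nu (X j) *m X k)).
    by apply: eq_bigr => k _; rewrite !ropE.
  by rewrite sum_onb_adjoint; apply: eq_bigr => k _; rewrite !ropE.
- apply: eq_bigr => i _.
  transitivity (\sum_k dot (lop mu (X i) *m (E *m X k)) (lop nu (X i) *m X k)).
    by apply: eq_bigr => k _; rewrite !lopE.
  by rewrite sum_onb_adjoint; apply: eq_bigr => k _; rewrite !lopE.
Qed.

Lemma ipV_eq (mu mu' nu nu' : V -> V -> V) : (forall x y, mu x y = mu' x y) ->
  (forall x y, nu x y = nu' x y) -> ipV dot X mu nu = ipV dot X mu' nu'.
Proof. by move=> h h'; rewrite !(ipVE hX); do 2![apply: eq_bigr => ? _]; rewrite h h'. Qed.

Lemma ipVDl (mu nu lam : V -> V -> V) (eta : V -> V -> V) (a : C) :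
  (forall x y, eta x y = a *: mu x y + nu x y) ->
  ipV dot X eta lam = a * ipV dot X mu lam + ipV dot X nu lam.
Proof.
move=> h; rewrite !(ipVE hX) mulr_sumr -big_split; apply: eq_bigr => i _ /=.
rewrite mulr_sumr -big_split; apply: eq_bigr => j _ /=.
by rewrite h linearDl /= (dotZl dot).
Qed.

Lemma ipV_eq0 (mu : bilin R n) : ipV dot X mu mu = 0 -> forall x y, mu x y = 0.
Proof.
move=> h x y; apply/eqP/negPn/negP => h0.
by have := sqnorm_neq0 hX (ex_intro _ x (ex_intro _ y h0)); rewrite h eqxx.
Qed.

Lemma ipV_ge0 (mu : V -> V -> V) : 0 <= ipV dot X mu mu.
Proof.
by rewrite (ipVE hX) sumr_ge0 // => i _; rewrite sumr_ge0 // => j _; exact: dnorm_ge0.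
Qed.

(** Since D.mu = 0, the commutator acts on mu as D.D*.mu, and [ipV_act] moves the outer D to the
    other side as D*. *)
Lemma ipV_act_commutator (mu : bilin R n) D : derivation D mu ->
  ipV dot X (act (D *m adj D - adj D *m D) mu) mu
  = ipV dot X (act (adj D) mu) (act (adj D) mu).
Proof.
move=> hD; rewrite -ipV_act; apply: ipV_eq => // x y.
rewrite act_commutator.
suff -> : act (adj D) (act D mu) x y = 0 by rewrite subr0.
by rewrite actE /= !hD mulmx0 !subr0.
Qed.

Lemma derivation_adjoint (mu : bilin R n) D c :
  (forall E, ipV dot X (act E mu) mu = c * \tr E) ->
  derivation D mu -> derivation (adj D) mu.
Proof.
move=> hc hD; apply: ipV_eq0.
by rewrite -ipV_act_commutator // hc mxtraceB mxtrace_mulC subrr mulr0.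
Qed.

(** [ip_Mop] gives the Hermitian case. Both sides are complex linear in [E], and every operator is A
    + iB with A and B Hermitian. *)
Lemma ip_MopE (mu : bilin R n) E :
  \tr (Mop dot X mu *m E) = 2 * ipV dot X (act E mu) mu.
Proof.
have herm A : hermitian_op dot A ->
    \tr (Mop dot X mu *m A) = 2 * ipV dot X (act A mu) mu.
  move=> hA; have := ip_Mop hX mu hA; rewrite /ip_gl hA => ->; congr (_ * _).
  rewrite (ipVE hX); apply: eq_bigr => i _; apply: eq_bigr => j _.
  by rewrite /act addrAC.
pose A : 'M[C]_n := 2^-1 *: E + 2^-1 *: adj E.
pose B : 'M[C]_n := (- 'i / 2) *: E + ('i / 2) *: adj E.
have h2 : (2^-1 : C)^* = 2^-1 by rewrite fmorphV rmorph_nat.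
have hA : hermitian_op dot A.
  by rewrite /hermitian_op /A adjointD !(adjointZ hX) (adjointK hX) h2 addrC.
have hB : hermitian_op dot B.
  rewrite /hermitian_op /B adjointD !(adjointZ hX) (adjointK hX) addrC.
  by rewrite !rmorphM /= h2 rmorphN /= conjCi opprK.
have EE : E = 'i *: B + A.
  rewrite /A /B scalerDr !scalerA addrACA -!scalerDl.
  rewrite !mulrA mulrN -expr2 sqrCi opprK mul1r mulN1r addNr scale0r addr0.
  by rewrite -[2^-1]mul1r -splitr scale1r.
clearbody A B; have -> : ipV dot X (act E mu) mu =
    'i * ipV dot X (act B mu) mu + ipV dot X (act A mu) mu.
  by rewrite [in LHS]EE; apply: ipVDl => x y; exact: act_linear.
rewrite [in LHS]EE mulmxDr -scalemxAr mxtraceD mxtraceZ (herm B) // (herm A) //.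
by rewrite mulrDr mulrCA.
Qed.

(** The identity matrix acts on V_n as -1, because mu - mu - mu = - mu. *)
Lemma tr_Mop (mu : bilin R n) : \tr (Mop dot X mu) = - 2 * ipV dot X mu mu.
Proof.
have z : ipV dot X (fun _ _ => 0) mu = 0.
  by rewrite (ipVE hX) big1 // => i _; rewrite big1 // => j _; rewrite linear0l.
rewrite -[Mop _ _ _]mulmx1 ip_MopE mulNr -mulrN; congr (_ * _).
rewrite -[RHS]addr0 -[X in _ = _ + X]z -mulN1r; apply: ipVDl => x y.
by rewrite /act !mul1mx subrr sub0r addr0 scaleN1r.
Qed.

End Hermitian.
End BilinearMaps.

(** * Leibniz algebras with a scalar moment map: kernel of [lop], derivations, ideals *)

Section CriticalPoints.
Variables (R : realType) (n : nat).
Local Notation C := R[i].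
Local Notation V := 'cV[C]_n.
Variables (dot : herm_prod R n) (X : 'I_n -> V).
Hypothesis hX : orthonormal_basis dot X.
Local Notation adj := (adjoint dot).
Implicit Types (mu : bilin R n) (D E : 'M[C]_n) (U : {vspace V}).

Fact lop_linear mu : linear (lop mu : V -> 'M[C]_n).
Proof.
by move=> a x y; apply/matrixP => i j; rewrite !mxE linearDl linearZl_LR !mxE.
Qed.

HB.instance Definition _ mu :=
  GRing.isLinear.Build C V 'M[C]_n *:%R (lop mu : V -> 'M[C]_n) (lop_linear mu).

Lemma derivation_lop D mu y : derivation D mu ->
  D *m lop mu y - lop mu y *m D = lop mu (D *m y).
Proof.
move=> /derivationP hD; apply: mulmx_inj => z.
by rewrite mulmxBl -!mulmxA !lopE hD addrK.
Qed.

Lemma derivation_lopP mu x : leibniz mu -> derivation (lop mu x) mu.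
Proof. by move=> h; apply/derivationP => y z; rewrite !lopE; exact: h. Qed.

Lemma derivationB D E mu : derivation D mu -> derivation E mu -> derivation (D - E) mu.
Proof. by move=> hD hE x y; rewrite actB hD hE subrr. Qed.

Lemma orthogonal_projector U : exists E,
  [/\ adj E = E, forall x, E *m x \in U & forall x, x \in U -> E *m x = x].
Proof.
have split_ x : exists y, y \in U /\ forall u, u \in U -> dot (x - y) u = 0.
  have [y + [z [-> _ hz]]] := orthogonal_split dot (vbasis U) x.
  rewrite (span_basis (vbasisP U)) => hy; exists y; split=> // u uU.
  rewrite addrAC subrr add0r; apply: (span_orthogonal hz); first exact: memv_span1.
  by rewrite (span_basis (vbasisP U)).
have [p hp] := choice split_.
pose E : 'M[C]_n := \matrix_(i, j) p (delta_mx j 0) i 0.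
have EE x : E *m x = \sum_j x j 0 *: p (delta_mx j 0).
  apply/colP => i; rewrite mxE summxE; apply: eq_bigr => j _.
  by rewrite !mxE mulrC.
have EU x : E *m x \in U.
  by rewrite EE rpred_sum // => j _; rewrite rpredZ //; have [] := hp (delta_mx j 0).
have Eo x u : u \in U -> dot (x - E *m x) u = 0.
  move=> uU; rewrite EE {1}[x]cV_sum -sumrB (dot_suml dot) big1 // => j _.
  by rewrite -scalerBr (dotZl dot) (hp _).2 ?mulr0.
have dotE x y : dot (E *m x) y = dot (E *m x) (E *m y).
  apply/eqP; rewrite -subr_eq0 -(dotBr dot) (dotC dot) Eo ?conjC0 //.
exists E; split=> // [|x xU].
  apply: (adjoint_unique) => x y.
  by rewrite (dotC dot x) (dotE y x) -(dotC dot) -dotE.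
apply/eqP; rewrite eq_sym -subr_eq0 -(dnorm_eq0 dot) Eo //.
by rewrite rpredB.
Qed.

(** Invariance gives EAE = AE and EA*E = A*E; the adjoint of the second equation is EAE = EA. *)
Lemma projector_comm U E A :
  [/\ adj E = E, forall x, E *m x \in U & forall x, x \in U -> E *m x = x] ->
  (forall x, x \in U -> A *m x \in U) -> (forall x, x \in U -> adj A *m x \in U) ->
  E *m A = A *m E.
Proof.
move=> [aE EU Eid] hA hA'.
have e1 : E *m (A *m E) = A *m E.
  by apply: mulmx_inj => x; rewrite -!mulmxA Eid // hA.
have e2 : E *m (adj A *m E) = adj A *m E.
  by apply: mulmx_inj => x; rewrite -!mulmxA Eid // hA'.
have := congr1 adj e2; rewrite !(adjointM hX) aE (adjointK hX) => <-.
by rewrite -mulmxA e1.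
Qed.

(** For an orthogonal projector, tr E = tr E E* is the squared norm of E. *)
Lemma projector_tr0 U E :
  [/\ adj E = E, forall x, E *m x \in U & forall x, x \in U -> E *m x = x] ->
  \tr E = 0 -> U = 0%VS.
Proof.
move=> [aE EU Eid] tE.
have E0 : E = 0.
  apply: (ip_gl_eq0 hX); rewrite /ip_gl aE -[RHS]tE; congr (\tr _).
  by apply: mulmx_inj => x; rewrite -mulmxA Eid.
apply/eqP; rewrite -subv0; apply/subvP => x /Eid <-.
by rewrite E0 mul0mx mem0v.
Qed.

(** The proof of orthonormality is an argument so that the dot product instances below, whose proofs
    rely on it, can be attached to this constant. *)
Definition gl_form of orthonormal_basis dot X : 'M[C]_n -> 'M[C]_n -> C := ip_gl dot.

Fact gl_form_bilinear : bilinear_for *%R (@Num.conj C \; *%R) (gl_form hX).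
Proof.
split=> [A|A] a F G; rewrite /gl_form /ip_gl.
  by rewrite mulmxDl -scalemxAl mxtraceD mxtraceZ.
by rewrite (adjointD hX) (adjointZ hX) mulmxDr -scalemxAr mxtraceD mxtraceZ.
Qed.

HB.instance Definition _ := bilinear_isBilinear.Build C 'M[C]_n 'M[C]_n C
  *%R (@Num.conj C \; *%R) (gl_form hX) gl_form_bilinear.

Fact gl_form_hermitian A B : gl_form hX A B = (-1) ^+ false * (gl_form hX B A)^*.
Proof.
by rewrite expr0 mul1r /gl_form /ip_gl -(tr_adjoint hX) (adjointM hX) (adjointK hX).
Qed.

HB.instance Definition _ := isHermitianSesquilinear.Build C 'M[C]_n
  false (@Num.conj C) (gl_form hX) gl_form_hermitian.

Fact gl_form_gt0 A : A != 0 -> 0 < gl_form hX A A.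
Proof.
move=> A0; rewrite lt_def; apply/andP; split.
  by apply: contra A0 => /eqP /(ip_gl_eq0 hX) ->.
rewrite /gl_form /ip_gl mxtrace_mulC (tr_onb hX) sumr_ge0 // => i _.
by rewrite -mulmxA (adjointP' hX); exact: dnorm_ge0.
Qed.

HB.instance Definition _ := isDotProduct.Build C 'M[C]_n (gl_form hX) gl_form_gt0.

(* A derivation [D] orthogonal to the inner ones satisfies [ad (D y) = [D, ad y]],
   which is both inner and orthogonal to the inner derivations. *)
Lemma derivation_inner mu : leibniz mu ->
  (forall x, lop mu x = 0 -> x = 0) ->
  (forall D, derivation D mu -> derivation (adj D) mu) ->
  forall D, derivation D mu -> exists x, D = lop mu x.
Proof.
move=> hmu hinj hadj D hD.
pose S := [seq linfun (lop mu : V -> 'M[C]_n) e | e <- vbasis {:V}].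
have SE : <<S>>%VS = limg (linfun (lop mu : V -> 'M[C]_n)).
  by rewrite -limg_span (span_basis (vbasisP _)).
have [A hA [N [DE _ oN]]] := orthogonal_split (gl_form hX) S D.
have [x xE] : exists x, A = lop mu x.
  by move: hA; rewrite SE => /memv_imgP[x _ ->]; exists x; rewrite lfunE.
exists x.
have NE : N = D - lop mu x by rewrite DE xE addrAC subrr add0r.
have hN : derivation N mu by rewrite NE; apply: derivationB => //; exact: derivation_lopP.
have oN' y : \tr (N *m adj (lop mu y)) = 0.
  apply: (span_orthogonal oN); first exact: memv_span1.
  by rewrite SE -(lfunE (lop mu : V -> 'M[C]_n)) memv_img ?memvf.
(* By cyclicity this is the trace of N [L_y, L_z*]. That commutator is the adjoint of [L_z, L_y*],
   which is minus the left multiplication by L_y* z since L_y* is a derivation; [N] is orthogonal to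
   it. *)
have comm y z : \tr (lop mu (N *m y) *m adj (lop mu z)) = 0.
  rewrite -derivation_lop // mulmxBl raddfB /= -mulmxA.
  have -> : \tr (lop mu y *m N *m adj (lop mu z)) = \tr (N *m (adj (lop mu z) *m lop mu y)).
    by rewrite -mulmxA mxtrace_mulC mulmxA.
  rewrite -(raddfB (@mxtrace C n)) /= -mulmxBr.
  have -> : lop mu y *m adj (lop mu z) - adj (lop mu z) *m lop mu y =
      adj (lop mu z *m adj (lop mu y) - adj (lop mu y) *m lop mu z).
    by rewrite (adjointB hX) !(adjointM hX) (adjointK hX).
  have hd := hadj _ (derivation_lopP y hmu).
  have <- : - lop mu (adj (lop mu y) *m z) =
      lop mu z *m adj (lop mu y) - adj (lop mu y) *m lop mu z.
    by rewrite -derivation_lop // opprB.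
  by rewrite -scaleN1r (adjointZ hX) -scalemxAr mxtraceZ oN' mulr0.
have N0 : N = 0.
  apply: mulmx_inj => y; rewrite mul0mx; apply: hinj; apply: (ip_gl_eq0 hX); exact: comm.
by apply/eqP; rewrite -subr_eq0 -NE N0.
Qed.

(* The orthogonal projector onto the kernel of [lop mu] is a derivation. *)
Lemma critical_lop_inj mu c : leibniz mu -> c != 0 ->
  (forall E, ipV dot X (act E mu) mu = c * \tr E) ->
  forall x, lop mu x = 0 -> x = 0.
Proof.
move=> hmu c0 hc.
pose Z := lker (linfun (lop mu : V -> 'M[C]_n)).
have ZP x : (x \in Z) = (lop mu x == 0) by rewrite memv_ker lfunE.
have derZ D : derivation D mu -> forall x, x \in Z -> D *m x \in Z.
  move=> hD x; rewrite !ZP => /eqP x0.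
  by rewrite -derivation_lop // x0 mulmx0 mul0mx subrr.
have [E hE] := orthogonal_projector Z.
have [_ EZ _] := hE.
(* [mu (E *m x) y] vanishes because [E *m x] lies in [Z], so the derivation rule reduces to [E]
   commuting with [lop mu x]. It does, because [Z] is stable under this derivation and its
   adjoint. *)
have derE : derivation E mu.
  apply/derivationP => x y.
  have := EZ x; rewrite ZP => /eqP /(congr1 (fun A : 'M_n => A *m y)).
  rewrite lopE mul0mx => ->; rewrite add0r -!lopE !mulmxA; congr (_ *m _).
  have hx := derivation_lopP x hmu.
  apply: (projector_comm hE); apply: derZ => //.
  exact: (derivation_adjoint hX hc).
have tE : \tr E = 0.
  have /eqP := hc E; rewrite eq_sym; have -> : ipV dot X (act E mu) mu = 0.
    by rewrite (ipVE hX) big1 // => i _; rewrite big1 // => j _; rewrite derE linear0l.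
  by rewrite mulf_eq0 (negPf c0) => /eqP.
have Z0 := projector_tr0 hE tE.
move=> x /eqP; rewrite -ZP Z0 memv0 => /eqP //.
Qed.

(** The working form of semisimplicity; [semisimple_lieP] links it to solvable ideals. *)
Definition abelian_ideals_trivial (mu : V -> V -> V) := forall U, ideal mu U ->
  (forall x y, x \in U -> y \in U -> mu x y = 0) -> U = 0%VS.

Lemma alternating_anticomm mu : (forall x, mu x x = 0) -> forall x y, mu x y = - mu y x.
Proof.
move=> alt x y; apply/eqP; rewrite -addr_eq0; apply/eqP.
by have := alt (x + y); rewrite linearDl !linearDr !alt add0r addr0.
Qed.

Lemma leibniz_alternating_lie mu : leibniz mu -> (forall x, mu x x = 0) -> lie_algebra mu.
Proof.
move=> hmu alt; have anti := alternating_anticomm alt.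
split=> // x y z.
rewrite [mu y (mu z x)]anti [mu z (mu x y)]anti (hmu x y z) [mu z x]anti linearNl opprK.
by rewrite [mu (mu x z) y]anti addrK subrr.
Qed.

(** The Leibniz identity with y = x reads (xx)z = 0, so left multiplication by xx is zero. *)
Lemma leibniz_lie mu : leibniz mu ->
  (forall x, lop mu x = 0 -> x = 0) -> lie_algebra mu.
Proof.
move=> hmu hinj; apply: leibniz_alternating_lie => // x.
apply: hinj; apply: mulmx_inj => z; rewrite lopE mul0mx.
by have /eqP := hmu x x z; rewrite eq_sym -subr_eq0 addrK => /eqP.
Qed.

Lemma lie_leibniz mu : lie_algebra mu -> leibniz mu.
Proof.
move=> [alt jac].
have anti := alternating_anticomm alt.
move=> x y z.
have := jac x y z; rewrite [mu y (mu z x)]anti [mu z (mu x y)]anti [mu z x]anti.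
rewrite linearNl opprK [mu (mu x z) y]anti => /eqP.
by rewrite -addrA addr_eq0 opprD opprK opprK addrC => /eqP.
Qed.

(** The adjoints of left multiplications are derivations, hence inner, so they preserve [U] and the
    projector [E] commutes with every L_x. For u in [U], L_u kills [U], and L_u (1 - E) = E L_u (1 -
    E) = L_u E (1 - E) = 0. Hence L_u = 0 and u = 0. *)
Lemma critical_abelian_ideals mu c : leibniz mu -> c != 0 ->
  (forall E, ipV dot X (act E mu) mu = c * \tr E) -> abelian_ideals_trivial mu.
Proof.
move=> hmu c0 hc U hU abU.
have hinj := critical_lop_inj hmu c0 hc.
have hder D := derivation_adjoint hX (D := D) hc.
have [E hE] := orthogonal_projector U; have [aE EU Eid] := hE.
have LU y x : x \in U -> lop mu y *m x \in U by rewrite lopE => /(hU y)[].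
have comm x : E *m lop mu x = lop mu x *m E.
  apply: (projector_comm hE); first exact: LU.
  have [y ->] := derivation_inner hmu hinj hder (hder _ (derivation_lopP x hmu)).
  exact: LU.
apply/eqP; rewrite -subv0; apply/subvP => u uU; rewrite memv0; apply/eqP.
apply: hinj; apply: mulmx_inj => x; rewrite mul0mx -(subrK (E *m x) x).
rewrite mulmxDr [X in _ + X]lopE abU ?EU // addr0.
have <- : E *m (lop mu u *m (x - E *m x)) = lop mu u *m (x - E *m x).
  by rewrite Eid // lopE; have [] := hU (x - E *m x) u uU.
rewrite mulmxA comm -mulmxA mulmxBr [E *m (E *m x)]Eid ?EU // subrr mulmx0 //.
Qed.

End CriticalPoints.

(** * Semisimplicity through abelian ideals, orbits, and the lower bound on [Fn] *)

Section Semisimplicity.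
Variables (R : realType) (n : nat).
Local Notation C := R[i].
Local Notation V := 'cV[C]_n.
Implicit Types (mu lam : bilin R n) (U W : {vspace V}).

Lemma mem_derived mu U x y : x \in U -> y \in U -> mu x y \in derived mu U.
Proof.
move=> /coord_vbasis -> /coord_vbasis ->; rewrite linear_sumlz rpred_sum // => i _.
rewrite linear_sumr rpred_sum // => j _.
rewrite linearZl_LR linearZr_LR !rpredZ // memv_span //.
by apply/allpairsP; exists ((vbasis U)`_i, (vbasis U)`_j); rewrite !mem_nth ?size_tuple.
Qed.

Lemma derived_le mu U W : (forall x y, x \in U -> y \in U -> mu x y \in W) ->
  (derived mu U <= W)%VS.
Proof.
move=> h; apply/span_subvP => _ /allpairsP[[a b] [/= ha hb ->]].
by apply: h; apply: vbasis_mem.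
Qed.

Lemma ideal_derived mu U : lie_algebra mu -> ideal mu U -> ideal mu (derived mu U).
Proof.
move=> hl hU; have lei := lie_leibniz hl.
have anti := alternating_anticomm hl.1.
have h x : (derived mu U <= linfun (mulmx (lop mu x) : V -> V) @^-1: derived mu U)%VS.
  apply: derived_le => a b aU bU; rewrite -memv_preim lfunE /= lopE lei rpredD // mem_derived //.
    by apply: (hU x a _).1.
  by apply: (hU x b _).1.
have {}h x y : y \in derived mu U -> mu x y \in derived mu U.
  by move=> /(subvP (h x)); rewrite -memv_preim lfunE /= lopE.
by move=> x y yU; split; [exact: h | rewrite anti rpredN; exact: h].
Qed.

(** Induction on the length of the derived series: the derived ideal is solvable in one step fewer,
    hence zero, and so the ideal itself is abelian. *)
Lemma semisimple_lieP mu :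
  semisimple_lie mu <-> lie_algebra mu /\ abelian_ideals_trivial mu.
Proof.
split=> -[hl h]; split=> // U hU.
  move=> ab; apply: h => //; exists 1%N => /=.
  by apply/eqP; rewrite -subv0; apply: derived_le => x y xU yU; rewrite ab ?mem0v.
case=> k; elim: k U hU => [//|k IH] U hU; rewrite iterSr => hk.
have D0 : derived mu U = 0%VS by apply: IH => //; exact: ideal_derived.
apply: h => // x y xU yU; apply/eqP.
by rewrite -memv0 -D0 mem_derived.
Qed.

Section Orbit.
Variables (mu lam : bilin R n) (g : 'M[C]_n) (c : C).
Hypotheses (ug : g \in unitmx) (c0 : c != 0).
Hypothesis lamE : forall x y, lam x y = c *: gl_act g mu x y.

Lemma orbit_mulmx x y : lam (g *m x) (g *m y) = c *: (g *m mu x y).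
Proof. by rewrite lamE /gl_act !mulKmx. Qed.

Lemma orbit_alternating : (forall x, lam x x = 0) -> forall x, mu x x = 0.
Proof.
move=> h x; have /eqP := orbit_mulmx x x; rewrite h eq_sym scaler_eq0 (negPf c0) /=.
by move=> /eqP /(congr1 (mulmx (invmx g))); rewrite mulKmx // mulmx0.
Qed.

Lemma orbit_abelian_ideals : abelian_ideals_trivial lam -> abelian_ideals_trivial mu.
Proof.
move=> h U hU ab.
pose f := linfun (mulmx g : V -> V).
have fE x : f x = g *m x by rewrite lfunE.
have W0 : (f @: U)%VS = 0%VS.
  apply: h => [x _ /memv_imgP[y yU ->]|_ _ /memv_imgP[x xU ->] /memv_imgP[y yU ->]].
    rewrite -[x](mulKVmx ug) fE !orbit_mulmx -!fE.
    have [h1 h2] := hU (invmx g *m x) y yU.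
    by split; rewrite rpredZ // memv_img.
  by rewrite !fE orbit_mulmx ab // mulmx0 scaler0.
apply/eqP; rewrite -subv0; apply/subvP => x xU; rewrite memv0.
have : f x == 0 by rewrite -memv0 -W0 memv_img.
by rewrite fE => /eqP /(congr1 (mulmx (invmx g))); rewrite mulKmx // mulmx0 => ->.
Qed.

End Orbit.

Variables (dot : herm_prod R n) (X : 'I_n -> V).
Hypothesis hX : orthonormal_basis dot X.
Local Notation adj := (adjoint dot).

Lemma tr_moment mu : nonzero mu -> \tr (moment dot X mu) = - 2.
Proof.
move=> h; rewrite (momentE hX) mxtraceZ (tr_Mop hX) mulrCA mulVf ?mulr1 //.
exact: (sqnorm_neq0 hX).
Qed.

Lemma ip_moment mu (a : C) : nonzero mu -> a^* = a ->
  let A := moment dot X mu + a%:M in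
  ip_gl dot A A = ip_gl dot (moment dot X mu) (moment dot X mu) - 4 * a + n%:R * a ^+ 2.
Proof.
move=> h ra A.
have hm : adj (moment dot X mu) = moment dot X mu.
  by rewrite (momentE hX); have [] := moment_spec hX mu.
have ha : adj a%:M = a%:M.
  by apply: (adjoint_unique) => x y; rewrite !mul_scalar_mx (dotZl dot) (dotZr dot) ra.
rewrite /ip_gl (adjointD hX) hm ha mulmxDl !mulmxDr !mxtraceD scalar_mxC.
rewrite !mul_scalar_mx scale_scalar_mx mxtrace_scalar !mxtraceZ tr_moment //.
by rewrite -expr2 -[a ^+ 2 *+ n]mulr_natl; ring.
Qed.

Lemma Fn_bound mu : nonzero mu ->
  4 / n%:R <= Fn dot X mu /\
  (Fn dot X mu = 4 / n%:R <-> moment dot X mu = (- (2 / n%:R))%:M).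
Proof.
move=> h.
have n0 : (n != 0)%N.
  apply/eqP => n0; case: h => x [y /eqP []]; apply/colP => i.
  by move: (ltn_ord i); rewrite {2}n0.
have nC : n%:R != 0 :> C by rewrite pnatr_eq0.
(* Adding 2/n makes the moment map, of trace -2, traceless. Then |m|^2 = |m + a|^2 + 4/n, which is
   Cauchy-Schwarz with its equality case. *)
pose a : C := 2 / n%:R.
have ra : a^* = a by rewrite /a rmorphM fmorphV !rmorph_nat.
have := ip_moment h ra; rewrite /=; set A := _ + _; set q := ip_gl _ A A.
move=> qE.
have q0 : 0 <= q by exact: (dnorm_ge0 (gl_form hX)).
have mE : ip_gl dot (moment dot X mu) (moment dot X mu) = q + real_complex R (4 / n%:R).
  rewrite qE rmorphM fmorphV !rmorph_nat /a; field.
  exact: nC.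
have FE : Fn dot X mu = complex.Re q + 4 / n%:R by rewrite /Fn mE raddfD.
have [q1 q2] : complex.Im q = 0 /\ 0 <= complex.Re q.
  by move: q0; case: (q) => x y; rewrite lecE /= => /andP[/eqP].
split; first by rewrite FE lerDr.
have mA : moment dot X mu = A - a%:M by rewrite /A addrK.
split=> [FE'|mE'].
  have : A = 0.
    apply: (ip_gl_eq0 hX); rewrite -/q; apply/eqP; rewrite eq_complex q1 eqxx andbT.
    by move: FE'; rewrite FE => /eqP; rewrite -subr_eq0 addrK.
  by rewrite mA => ->; rewrite sub0r raddfN.
suff q0' : q = 0 by rewrite FE q0' add0r.
by rewrite /q /A mE' raddfN addNr /ip_gl mul0mx mxtrace0.
Qed.

Lemma scalar_moment_critical mu a : nonzero mu -> moment dot X mu = a%:M ->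
  forall E, ipV dot X (act E mu) mu = (a * ipV dot X mu mu / 2) * \tr E.
Proof.
move=> h; have p0 := sqnorm_neq0 hX h.
rewrite (momentE hX) => /(congr1 (fun A => ipV dot X mu mu *: A)).
rewrite scalerA mulfV // scale1r => hM E.
have := ip_MopE hX mu E; rewrite hM scale_scalar_mx mul_scalar_mx mxtraceZ => e.
have n2 : (2 : C) != 0 by rewrite pnatr_eq0.
apply: (mulfI n2); rewrite -e mulrA [a * _]mulrC [_ / 2]mulrC mulrA mulfV // mul1r //.
Qed.

Lemma scalar_moment_semisimple mu a : leibniz mu -> nonzero mu -> a != 0 ->
  moment dot X mu = a%:M -> lie_algebra mu /\ abelian_ideals_trivial mu.
Proof.
move=> hmu h a0 hm; have hc := scalar_moment_critical h hm.
have c0 : a * ipV dot X mu mu / 2 != 0.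
  by rewrite !mulf_neq0 ?(sqnorm_neq0 hX) // invr_neq0 // pnatr_eq0.
split; last exact: (critical_abelian_ideals hX hmu c0 hc).
exact: (leibniz_lie hmu (critical_lop_inj hX hmu c0 hc)).
Qed.

End Semisimplicity.

(** * The standard Hermitian product on column vectors *)

Section StandardForm.
Variables (R : realType) (m : nat).
Local Notation C := R[i].
Local Notation V := 'cV[C]_m.

Definition stdot (x y : V) : C := \sum_i x i 0 * (y i 0)^*.

Fact stdot_bilinear : bilinear_for *%R (@Num.conj C \; *%R) stdot.
Proof.
split=> x a u v; rewrite /stdot /= mulr_sumr -big_split /=; apply: eq_bigr => i _.
  by rewrite !mxE mulrDl mulrA.
by rewrite !mxE rmorphD rmorphM mulrDr mulrCA.
Qed.

HB.instance Definition _ := bilinear_isBilinear.Build C V V C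
  *%R (@Num.conj C \; *%R) stdot stdot_bilinear.

Fact stdot_hermitian x y : stdot x y = (-1) ^+ false * (stdot y x)^*.
Proof.
rewrite expr0 mul1r rmorph_sum; apply: eq_bigr => i _.
by rewrite rmorphM /= conjCK mulrC.
Qed.

HB.instance Definition _ := isHermitianSesquilinear.Build C V
  false (@Num.conj C) stdot stdot_hermitian.

Fact stdot_gt0 x : x != 0 -> 0 < stdot x x.
Proof.
move=> x0; rewrite lt_def; apply/andP; split; last first.
  by rewrite sumr_ge0 // => i _; rewrite mul_conjC_ge0.
apply: contra x0; rewrite psumr_eq0 => [/allP h|i _]; last by rewrite mul_conjC_ge0.
apply/eqP/colP => i; rewrite mxE; apply/eqP.
by have := h i (mem_index_enum i); rewrite /= mul_conjC_eq0.
Qed.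

HB.instance Definition _ := isDotProduct.Build C V stdot stdot_gt0.

Definition std_basis (i : 'I_m) : V := delta_mx i 0.

Lemma stdot_basis x i : stdot x (std_basis i) = x i 0.
Proof.
rewrite /stdot (bigD1 i) //= big1 => [|j ji]; rewrite !mxE ?(negPf ji) ?andbT ?eqxx.
  by rewrite conjC1 mulr1 addr0.
by rewrite conjC0 mulr0.
Qed.

Lemma std_basis_onb : orthonormal_basis stdot std_basis.
Proof. by move=> i j; rewrite /= stdot_basis !mxE andbT eq_sym. Qed.

Local Notation adj := (adjoint stdot).
Local Notation nrm2 A := (ip_gl stdot A A).
Local Notation hX := std_basis_onb.

Lemma adjoint_std A i j : adj A i j = (A j i)^*.
Proof.
have colE (B : 'M[C]_m) k l : (B *m std_basis l) k 0 = B k l.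
  rewrite mxE (bigD1 l) //= big1 => [|q ql]; rewrite !mxE ?(negPf ql) ?eqxx.
    by rewrite mulr1 addr0.
  by rewrite mulr0.
rewrite -(colE (adj A)) -stdot_basis.
have -> : stdot (adj A *m std_basis j) (std_basis i) = stdot (std_basis j) (A *m std_basis i).
  exact: (adjointP' hX).
by rewrite stdot_hermitian expr0 mul1r stdot_basis colE.
Qed.

Lemma ip_gl_std A B : ip_gl stdot A B = \sum_i \sum_j A i j * (B i j)^*.
Proof.
apply: eq_bigr => i _; rewrite mxE; apply: eq_bigr => j _.
by rewrite adjoint_std.
Qed.

Lemma nrm2_entry (A : 'M[C]_m) i j : `|A i j| ^+ 2 <= nrm2 A.
Proof.
rewrite ip_gl_std (bigD1 i) //= (bigD1 j) //= -normCK -addrA lerDl addr_ge0 ?sumr_ge0 //.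
  by move=> k _; rewrite mul_conjC_ge0.
by move=> k _; rewrite sumr_ge0 // => l _; rewrite mul_conjC_ge0.
Qed.

(** Cauchy-Schwarz on each row of [A]. *)
Lemma nrm2_mulmx (A : 'M[C]_m) (x : V) : stdot (A *m x) (A *m x) <= nrm2 A * stdot x x.
Proof.
rewrite ip_gl_std mulr_suml; apply: ler_sum => i _.
pose r : V := \col_j (A i j)^*.
have -> : (A *m x) i 0 = stdot x r.
  by rewrite mxE; apply: eq_bigr => j _; rewrite !mxE conjCK mulrC.
rewrite -normCK mulrC; have -> : \sum_j A i j * (A i j)^* = stdot r r.
  by apply: eq_bigr => j _; rewrite !mxE conjCK mulrC.
by rewrite CauchySchwarz.
Qed.

End StandardForm.

(** * First-order conditions at minimisers of the energy *)

Section FirstOrder.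
Variable R : realType.
Local Notation C := R[i].

(** If Re b were negative, the term t b would outweigh the quadratic remainder at small t > 0 and
    push F below a. *)
Lemma expa_min (F : R -> C) a b : expa F a b ->
  (forall t, a <= F t) -> 0 <= complex.Re b.
Proof.
move=> [r [K hK] hr] hF.
rewrite leNgt; apply/negP => b0.
pose k := `|complex.Re K| + 1.
have k0 : 0 < k by rewrite ltr_wpDl.
(* For 0 < t < B the remainder term t k stays below half of - Re b. *)
have [B B0 Bk] : exists2 B, 0 < B & B * k = - complex.Re b / 2.
  exists (- complex.Re b / (2 * k)); first by rewrite divr_gt0 ?mulr_gt0 ?oppr_gt0 ?ltr0n.
  by field; rewrite gt_eqF.
have : \forall t \near (0 : R), 0 < t -> t < B -> False.
  near=> t => t0 tB.
  have FE : F t = a + real_complex R t * b + real_complex R t ^+ 2 * r t by near: t.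
  have rK : `|r t| <= K by near: t.
  have rk : complex.Re (r t) <= k.
    have h : real_complex R `|complex.Re (r t)| <= K by apply: le_trans (normc_ge_Re _) rK.
    have {}h : `|complex.Re (r t)| <= complex.Re K.
      by move: h; case: (K) => x y; rewrite lecE /= => /andP[].
    rewrite (le_trans (ler_norm _)) // (le_trans h) // (le_trans (ler_norm _)) //.
    by rewrite lerDl.
  have ReZ (s : R) z : complex.Re (real_complex R s * z) = s * complex.Re z.
    by case: z => x y /=; rewrite mul0r subr0.
  have : complex.Re a <= complex.Re (F t).
    by move: (hF t); case: (a) (F t) => [? ?] [? ?]; rewrite lecE /= => /andP[].
  rewrite FE !raddfD /= -rmorphXn !ReZ -addrA lerDl expr2 -mulrA -mulrDr.
  rewrite pmulr_rge0 // => h.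
  have : complex.Re b + t * complex.Re (r t) < 0.
    rewrite -ltrBrDl sub0r (@le_lt_trans _ _ (t * k)) ?ler_pM2l //.
    rewrite (@lt_trans _ _ (B * k)) ?ltr_pM2r // Bk.
    by rewrite ltr_pdivrMr ?ltr0n // ltr_pMr ?oppr_gt0 // ltr1n.
  by rewrite ltNge h.
case/nbhs_ballP => e /= e0 he.
pose t := Num.min (e / 2) (B / 2).
have t0 : 0 < t by rewrite lt_min !divr_gt0 ?ltr0n.
apply: (he t) => //.
  rewrite -ball_normE /= sub0r normrN gtr0_norm // (@le_lt_trans _ _ (e / 2)) ?ge_min ?lexx //.
  by rewrite ltr_pdivrMr ?ltr0n // ltr_pMr // ltr1n.
rewrite (@le_lt_trans _ _ (B / 2)) ?ge_min ?lexx ?orbT //.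
by rewrite ltr_pdivrMr ?ltr0n // ltr_pMr // ltr1n.
Unshelve. all: by end_near. Qed.


Variable m : nat.
Local Notation V := 'cV[C]_m.
Local Notation adj := (adjoint (@stdot R m)).
Local Notation nrm2 A := (ip_gl (@stdot R m) A A).
Local Notation ip := (ipV (@stdot R m) (@std_basis R m)).
Local Notation hX := (@std_basis_onb R m).

Lemma delta_mx_mul (i j k l : 'I_m) :
  (delta_mx i j : 'M[C]_m) *m (delta_mx k l) = (j == k)%:R *: delta_mx i l.
Proof. by rewrite mul_delta_mx_cond scaler_nat. Qed.

Lemma det_transvection (i j : 'I_m) (c : C) : i != j ->
  \det (1%:M + c *: delta_mx i j : 'M[C]_m) = 1.
Proof.
have trig (k l : 'I_m) : (l < k)%N -> \det (1%:M + c *: delta_mx k l : 'M[C]_m) = 1.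
  move=> lk; rewrite det_trig; last first.
    apply/is_trig_mxP => p q pq; rewrite !mxE (_ : (p == q) = false).
      rewrite add0r (_ : (p == k) && (q == l) = false) ?mulr0 //.
      apply/negP => /andP[/eqP ? /eqP ?]; subst.
      by have := ltn_trans lk pq; rewrite ltnn.
    by apply/negbTE; rewrite neq_ltn pq.
  rewrite big1 // => p _; rewrite !mxE eqxx (_ : (p == k) && (p == l) = false).
    by rewrite mulr0 addr0.
  by apply/negP => /andP[/eqP ? /eqP ?]; subst; rewrite ltnn in lk.
rewrite neq_ltn => /orP[ij|]; last exact: trig.
by rewrite -det_tr linearD linearZ /= trmx1 trmx_delta trig.
Qed.

(* Transvections and their conjugates span the traceless matrices. *)
Lemma trace_functional (f : 'M[C]_m -> C) :
  (forall a A B, f (a *: A + B) = a * f A + f B) ->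
  (forall E, (forall c, \det (1%:M + c *: E) = 1) -> f E = 0) ->
  exists a, forall A, f A = a * \tr A.
Proof.
move=> flin fE.
have f0 : f 0 = 0.
  have := flin 1 0 0; rewrite scaler0 addr0 mul1r => /eqP.
  by rewrite eq_sym -subr_eq0 addrK => /eqP.
have off i j : i != j -> f (delta_mx i j) = 0.
  by move=> ij; apply: fE => c; exact: det_transvection.
have fD A B : f (A + B) = f A + f B by rewrite -[A]scale1r flin mul1r scale1r.
have fN A : f (- A) = - f A.
  by apply/eqP; rewrite -addr_eq0 -fD addNr f0.
(* Conjugating E_ij by T = 1 + E_ji gives E_ij + E_jj - E_ii - E_ji. This is still an admissible
   direction, so [f] kills it, and [f] also kills the off-diagonal units. *)
have dia i j : f (delta_mx i i) = f (delta_mx j j).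
  have [->//|ij] := eqVneq i j.
  pose T : 'M[C]_m := 1%:M + delta_mx j i.
  pose T' : 'M[C]_m := 1%:M - delta_mx j i.
  have ji : (i == j) = false by apply/negbTE.
  have TT' : T *m T' = 1%:M.
    rewrite /T /T' mulmxDl !mulmxBr !mul1mx !mulmx1 delta_mx_mul ji scale0r subr0.
    by rewrite subrK.
  have TET : T *m delta_mx i j *m T' =
      delta_mx i j + delta_mx j j - delta_mx i i - delta_mx j i.
    rewrite /T /T' mulmxDl mul1mx delta_mx_mul eqxx scale1r mulmxBr mulmx1 mulmxDl.
    by rewrite !delta_mx_mul eqxx !scale1r opprD addrA.
  clearbody T T'.
  have h : f (T *m delta_mx i j *m T') = 0.
    apply: fE => c.
    have -> : 1%:M + c *: (T *m delta_mx i j *m T') = T *m (1%:M + c *: delta_mx i j) *m T'.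
      by rewrite mulmxDr mulmx1 mulmxDl TT' -scalemxAr -scalemxAl.
    by rewrite !det_mulmx det_transvection // mulr1 -det_mulmx TT' det1.
  move: h; rewrite TET !fD !fN (off i j ij) (off j i) ?[j == i]eq_sym // add0r subr0 => /eqP.
  by rewrite subr_eq0 => /eqP.
have fsum I r (P : pred I) (F : I -> 'M[C]_m) :
    f (\sum_(i <- r | P i) F i) = \sum_(i <- r | P i) f (F i).
  by apply: (big_morph f) => //; exact: fD.
have fZ a A : f (a *: A) = a * f A by rewrite -[a *: A]addr0 flin f0 addr0.
case: (pickP 'I_m) => [i0 _|no]; last first.
  exists 0 => A; rewrite mul0r (_ : A = 0) ?f0 //.
  by apply/matrixP => i; have := no i.
exists (f (delta_mx i0 i0)) => A.
rewrite [in LHS](matrix_sum_delta A) fsum mulr_sumr; apply: eq_bigr => i _.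
rewrite fsum (bigD1 i) //= big1 => [|j ji]; rewrite fZ.
  by rewrite addr0 mulrC (dia i i0).
by rewrite off 1?eq_sym // mulr0.
Qed.

Variable nu : bilin R m.

(** The term [t * nrm2 P] bounds minimising sequences when t > 0; the first term alone need not
    control [P]. *)
Definition energy (t : C) (P : 'M[C]_m) : C :=
  ip (gl_act P nu) (gl_act P nu) + t * nrm2 P.

Lemma expa_nrm (u : R -> V) a b : expam u a b ->
  expa (fun s => stdot (u s) (u s)) (stdot a a) (stdot b a + (stdot b a)^*).
Proof.
move=> hu; rewrite /stdot rmorph_sum -!big_split /=.
apply: expa_sum => i; rewrite rmorphM /= conjCK addrC [(b i 0)^* * _]mulrC.
exact: expaM (hu i 0) (expa_conj (hu i 0)).
Qed.

Lemma ip_gl_onb (A B : 'M[C]_m) :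
  ip_gl (@stdot R m) A B = \sum_k stdot (A *m std_basis R k) (B *m std_basis R k).
Proof.
rewrite /ip_gl mxtrace_mulC (tr_onb hX); apply: eq_bigr => k _.
by rewrite -mulmxA (adjointP' hX).
Qed.

Lemma gl_actM (G P : 'M[C]_m) x y : G \in unitmx -> P \in unitmx ->
  gl_act (G *m P) nu x y = gl_act G (gl_bilin P nu) x y.
Proof.
move=> uG uP; rewrite /gl_act /= /pushpull.
have -> : invmx (G *m P) = invmx P *m invmx G.
  have uGP : G *m P \in unitmx by rewrite unitmx_mul uG uP.
  by apply: (can_inj (mulmxK uGP)); rewrite mulVmx // -mulmxA mulKmx // mulVmx.
by rewrite -!mulmxA.
Qed.

(** [a] is the Lagrange multiplier of the constraint on the determinant. Directions E with det (1 +
    cE) = 1 for all c keep the curve (1 + sE)P inside the constraint, and [trace_functional] deduces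
    the formula for all E from these. *)
Lemma energy_critical (t : C) P : t^* = t -> P \in unitmx ->
  (forall Q, \det Q = \det P -> energy t P <= energy t Q) ->
  let lam := gl_bilin P nu in
  exists a, forall E, ip (act E lam) lam + t * \tr (E *m P *m adj P) = a * \tr E.
Proof.
move=> rt uP hmin lam.
pose f E := ip (act E lam) lam + t * \tr (E *m P *m adj P).
have flin a A B : f (a *: A + B) = a * f A + f B.
  have -> : f (a *: A + B) = a * ip (act A lam) lam + ip (act B lam) lam
      + t * \tr ((a *: A + B) *m P *m adj P).
    by congr (_ + _); apply: (ipVDl hX) => x y; exact: act_linear.
  rewrite /f !mulmxDl -!scalemxAl mxtraceD mxtraceZ.
  by rewrite !mulrDr [t * (a * _)]mulrCA addrACA.
(* Twice the real part of [f E] is the derivative at s = 0 of the energy along (1 + sE)P. *)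
have ge0 E : (forall c, \det (1%:M + c *: E) = 1) -> 0 <= complex.Re (f E).
  move=> hE.
  pose G (s : R) : 'M[C]_m := 1%:M + real_complex R s *: E.
  have uG s : G s \in unitmx by rewrite unitmxE hE unitr1.
  have actG s x y : gl_act (G s *m P) nu x y = gl_act (G s) lam x y by exact: gl_actM.
  have hw x y : expam (fun s => gl_act (G s *m P) nu x y) (lam x y) (act E lam x y).
    have hB (z : V) : expam (fun s => invmx (G s) *m z) z (- (E *m z)).
      have := expam_mul (expam_inv E) (expam_cst z).
      by rewrite mul1mx mulmx0 add0r mulNmx.
    have := expam_mul (expam_lin E) (expam_mu lam (hB x) (hB y)).
    rewrite !mul1mx linearNr linearNl => h k l.
    have -> : act E lam x y = - lam x (E *m y) - lam (E *m x) y + E *m lam x y.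
      by rewrite actE addrC addrA addrAC addrC addrA.
    by apply: expa_ext (h k l) => s; rewrite actG.
  have hP k : expam (fun s => G s *m P *m std_basis R k) (P *m std_basis R k)
      (E *m P *m std_basis R k).
    have := expam_mul (expam_lin E) (expam_cst (P *m std_basis R k)).
    rewrite mul1mx mulmx0 add0r mulmxA => h p q.
    by apply: expa_ext (h p q) => s; rewrite mulmxA.
  have e1 := expa_sum (fun i => expa_sum (fun j =>
    expa_nrm (hw (std_basis R i) (std_basis R j)))).
  have e2 := expaM (expa_cst t) (expa_sum (fun k => expa_nrm (hP k))).
  have e := expaD e1 e2.
  have eb : forall a b, expa (fun s => energy t (G s *m P)) a b ->
      a = energy t P -> b = f E + (f E)^* -> 0 <= complex.Re (f E).
    move=> a b hab aE bE; rewrite aE bE in hab.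
    have : 0 <= complex.Re (f E + (f E)^*).
      by apply: (expa_min hab) => s; apply: hmin; rewrite det_mulmx hE mul1r.
    by move: (f E) => [x y] /=; rewrite -mulr2n pmulrn_lge0.
  apply: eb (expa_ext _ e) _ _ => [s||].
  - by rewrite /energy (ipVE hX) ip_gl_onb.
  - by rewrite /energy (ipVE hX) ip_gl_onb.
  rewrite /f rmorphD rmorphM /= rt (ipVE hX) -/(ip_gl _ (E *m P) P) ip_gl_onb.
  rewrite mul0r addr0 addrACA; congr (_ + _).
    rewrite rmorph_sum -big_split; apply: eq_bigr => i _.
    by rewrite rmorph_sum -big_split.
  by rewrite -mulrDr; congr (_ * _); rewrite rmorph_sum -big_split.
apply: trace_functional => // E hE.
have hcE c c' : \det (1%:M + c' *: (c *: E)) = 1 by rewrite scalerA.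
have f0 : f 0 = 0.
  have := flin 1 0 0; rewrite scaler0 addr0 mul1r => /eqP.
  by rewrite eq_sym -subr_eq0 addrK => /eqP.
have fZ a A : f (a *: A) = a * f A by rewrite -[a *: A]addr0 flin f0 addr0.
(* Complex multiples of an admissible direction are admissible; the multiples 1, -1, i, -i force
   both the real and the imaginary part of [f E] to vanish. *)
have h c : 0 <= complex.Re (c * f E) by rewrite -fZ; apply: ge0.
suff : f E = 0 by [].
have h1 := h 1; have h2 := h (-1); have h3 := h (Complex 0 1); have h4 := h (Complex 0 (-1)).
move: h1 h2 h3 h4; rewrite mul1r mulN1r; case: (f E) => x y /=.
rewrite !mul0r !sub0r !mul1r !mulNr mul1r opprK !oppr_ge0 => x1 x2 y1 y2.
by apply/eqP; rewrite eq_complex /= !eq_le x1 x2 y1 y2.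
Qed.

(** The multiplier disappears on [D, D*], which is traceless. *)
Lemma energy_derivation (t : C) P D : t^* = t -> P \in unitmx ->
  (forall Q, \det Q = \det P -> energy t P <= energy t Q) ->
  derivation D (gl_bilin P nu) ->
  ip (act (adj D) (gl_bilin P nu)) (act (adj D) (gl_bilin P nu))
   + t * \tr ((D *m adj D - adj D *m D) *m P *m adj P) = 0.
Proof.
move=> rt uP hmin hD; have [a ha] := energy_critical rt uP hmin.
rewrite -(ipV_act_commutator hX hD) ha raddfB /= mxtrace_mulC subrr mulr0 //.
Qed.

End FirstOrder.

(** * Limits of complex sequences and matrices along an ultrafilter *)

Section UltraLimits.
Local Open Scope classical_set_scope.
Variables (R : realType) (U : set_system nat).
Hypothesis uU : UltraFilter U.
Local Notation C := R[i].

(** Along an ultrafilter every bounded sequence converges, so no subsequences have to be extracted.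
    In [C], [0 < e] includes that [e] is real. *)
Definition tends (z : nat -> C) (l : C) : Prop :=
  forall e : C, 0 < e -> \forall k \near U, `|l - z k| < e.

Lemma tends_cst c : tends (fun=> c) c.
Proof. by move=> e e0; apply: nearW => k; rewrite subrr normr0. Qed.

Lemma tendsD z w a b : tends z a -> tends w b -> tends (fun k => z k + w k) (a + b).
Proof.
move=> hz hw e e0; have e2 : 0 < e / 2 by rewrite divr_gt0 ?ltr0n.
apply: filterS2 (hz _ e2) (hw _ e2) => k h1 h2.
by rewrite opprD addrACA (le_lt_trans (ler_normD _ _)) // [e]splitr ltrD.
Qed.

Lemma tendsM z w a b : tends z a -> tends w b -> tends (fun k => z k * w k) (a * b).
Proof.
move=> hz hw e e0; have e2 : 0 < e / 2 by rewrite divr_gt0 ?ltr0n.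
have pos (c : C) : 0 < `|c| + 1 by rewrite ltr_wpDl.
have ea : 0 < e / 2 / (`|a| + 1) by rewrite divr_gt0.
have eb : 0 < e / 2 / (`|b| + 1) by rewrite divr_gt0.
have hw1 := hw _ (@ltr01 C).
apply: filterS3 (hz _ eb) (hw _ ea) hw1 => k h1 h2 h3.
have hwk : `|w k| <= `|b| + 1.
  by rewrite -[w k](subKr b) (le_trans (ler_normB _ _)) // lerD2l ltW.
have -> : a * b - z k * w k = a * (b - w k) + (a - z k) * w k by ring.
rewrite (le_lt_trans (ler_normD _ _)) // [e]splitr ler_ltD // normrM.
  apply: (@le_trans _ _ ((`|a| + 1) * (e / 2 / (`|a| + 1)))).
    by rewrite ler_pM // ?lerDl // ltW.
  by rewrite mulrC divfK // gt_eqF.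
by rewrite (le_lt_trans (ler_wpM2l _ hwk)) // -ltr_pdivlMr.
Qed.

Lemma tends_near z w l : (\forall k \near U, z k = w k) -> tends z l -> tends w l.
Proof.
move=> h hz e e0.
by apply: filterS2 h (hz e e0) => k ->.
Qed.

Lemma tends_ext z w l : (forall k, z k = w k) -> tends z l -> tends w l.
Proof. by move=> h; apply: tends_near; apply: nearW. Qed.

Lemma tends_conj z l : tends z l -> tends (fun k => (z k)^*) l^*.
Proof.
move=> h e e0; apply: filterS (h e e0) => k.
by rewrite -rmorphB norm_conjC.
Qed.

Lemma tends_norm z l : tends z l -> tends (fun k => `|z k|) `|l|.
Proof.
move=> h e e0; apply: filterS (h e e0) => k; apply: le_lt_trans.
exact: ler_dist_dist.
Qed.

Lemma tends_unique z a b : tends z a -> tends z b -> a = b.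
Proof.
move=> ha hb; apply/eqP; rewrite -subr_eq0 -normr_le0 real_leNgt ?num_real //.
apply/negP => h; have h2 : 0 < `|a - b| / 2 by rewrite divr_gt0 ?ltr0n.
have [k [h3 h4]] := filter_ex (filterI (ha _ h2) (hb _ h2)).
have : `|a - b| < `|a - b|.
  have {1}-> : a - b = (a - z k) - (b - z k) by ring.
  by rewrite (le_lt_trans (ler_normB _ _)) // [ltRHS]splitr ltrD.
by rewrite ltxx.
Qed.

(** A nonnegative sequence equals its sequence of norms, so l = |l| by uniqueness of limits. *)
Lemma tends_ge0 z l : (\forall k \near U, 0 <= z k) -> tends z l -> 0 <= l.
Proof.
move=> h hz.
have hn : tends z `|l|.
  by apply: tends_near (tends_norm hz); apply: filterS h => k /ger0_norm.
by rewrite (tends_unique hz hn).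
Qed.

Lemma tends_le z w a b : (\forall k \near U, z k <= w k) -> tends z a -> tends w b ->
  a <= b.
Proof.
move=> h hz hw; rewrite -subr_ge0; apply: (@tends_ge0 (fun k => w k + -1 * z k)).
  by apply: filterS h => k; rewrite mulN1r subr_ge0.
by have := tendsD hw (tendsM (tends_cst (-1)) hz); rewrite mulN1r.
Qed.

Lemma tends_sum (I : Type) (r : seq I) (P : pred I) (z : I -> nat -> C) l :
  (forall i, tends (z i) (l i)) ->
  tends (fun k => \sum_(i <- r | P i) z i k) (\sum_(i <- r | P i) l i).
Proof.
move=> h; elim: r => [|i r IH].
  by rewrite big_nil; apply: tends_ext (tends_cst 0) => k; rewrite big_nil.
rewrite big_cons; case: ifPn => Pi.
  by apply: tends_ext (tendsD (h i) IH) => k; rewrite big_cons Pi.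
by apply: tends_ext IH => k; rewrite big_cons (negPf Pi).
Qed.

Lemma tends_prod (I : Type) (r : seq I) (z : I -> nat -> C) l :
  (forall i, tends (z i) (l i)) ->
  tends (fun k => \prod_(i <- r) z i k) (\prod_(i <- r) l i).
Proof.
move=> h; elim: r => [|i r IH].
  by rewrite big_nil; apply: tends_ext (tends_cst 1) => k; rewrite big_nil.
rewrite big_cons; apply: tends_ext (tendsM (h i) IH) => k.
by rewrite big_cons.
Qed.

Lemma tends_real (x : nat -> R) a : (forall e, 0 < e -> \forall k \near U, `|a - x k| < e) ->
  tends (fun k => real_complex R (x k)) (real_complex R a).
Proof.
move=> h e e0.
have [e1 e2] : 0 < complex.Re e /\ e = real_complex R (complex.Re e).
  by move: e0; case: (e) => u v; rewrite ltcE /= => /andP[/eqP -> ->].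
apply: filterS (h _ e1) => k.
by rewrite -rmorphB /= {2}e2 normc_def /= expr0n addr0 sqrtr_sqr ltcR.
Qed.

(** Compactness of [-M, M] gives a cluster point of the image filter. The ultrafilter contains the
    preimage of each ball around it or of the complement, and the latter would contradict
    clustering. *)
Lemma real_ultralimit (x : nat -> R) (M : R) : (\forall k \near U, `|x k| <= M) ->
  exists a, forall e, 0 < e -> \forall k \near U, `|a - x k| < e.
Proof.
move=> hM.
have pF : ProperFilter (x @ U) by exact: fmap_proper_filter.
have [|p [_ hp]] := @segment_compact R (- M) M (x @ U) pF.
  by apply: filterS hM => k; rewrite /= in_itv /= ler_norml.
exists p => e e0.
have nb : nbhs p (ball p e) by exact: nbhsx_ballx.
have [|h] := in_ultra_setVsetC (x @^-1` (ball p e)) uU.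
  by apply: filterS => k; rewrite -ball_normE.
have [y [/= h1 h2]] := hp (~` ball p e) (ball p e) h nb.
by [].
Qed.

Lemma ultralimit (z : nat -> C) (M : C) : (\forall k \near U, `|z k| <= M) ->
  exists l, tends z l.
Proof.
move=> hM.
have hRI : \forall k \near U, `|complex.Re (z k)| <= complex.Re M /\
    `|complex.Im (z k)| <= complex.Re M.
  apply: filterS hM => k h.
  have normc_ge_Im (c : C) : real_complex R `|complex.Im c| <= `|c|.
    case: c => u v; rewrite normc_def /= lecR -sqrtr_sqr.
    by rewrite ler_sqrt ?addr_ge0 ?sqr_ge0 // lerDr sqr_ge0.
  have h1 := le_trans (normc_ge_Re _) h; have h2 := le_trans (normc_ge_Im _) h.
  by move: h1 h2; case: (M) => u v; rewrite !lecE /= => /andP[_ ->] /andP[_ ->].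
have [a ha] : exists a, forall e, 0 < e -> \forall k \near U, `|a - complex.Re (z k)| < e.
  by apply: (@real_ultralimit _ (complex.Re M)); apply: filterS hRI => k [].
have [b hb] : exists a, forall e, 0 < e -> \forall k \near U, `|a - complex.Im (z k)| < e.
  by apply: (@real_ultralimit _ (complex.Re M)); apply: filterS hRI => k [].
exists (real_complex R a + 'i * real_complex R b).
apply: tends_ext (tendsD (tends_real ha) (tendsM (tends_cst 'i) (tends_real hb))) => k.
by rewrite [RHS]complexE.
Qed.

Definition tendsm p q (Z : nat -> 'M[C]_(p, q)) (L : 'M[C]_(p, q)) :=
  forall i j, tends (fun k => Z k i j) (L i j).

Lemma tendsm_cst p q (A : 'M[C]_(p, q)) : tendsm (fun=> A) A.
Proof. by move=> i j; exact: tends_cst. Qed.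

Lemma tendsm_mul p q r (Y : nat -> 'M[C]_(p, q)) (Z : nat -> 'M[C]_(q, r)) A B :
  tendsm Y A -> tendsm Z B -> tendsm (fun k => Y k *m Z k) (A *m B).
Proof.
move=> hY hZ i j; rewrite mxE.
apply: tends_ext (tends_sum _ _ (fun l => tendsM (hY i l) (hZ l j))) => k.
by rewrite mxE.
Qed.

Lemma tends_det p (Z : nat -> 'M[C]_p) A : tendsm Z A ->
  tends (fun k => \det (Z k)) (\det A).
Proof.
move=> hZ; apply: tends_sum => s; apply: tendsM; first exact: tends_cst.
exact: tends_prod.
Qed.

Lemma tends_adj p (Z : nat -> 'M[C]_p) A : tendsm Z A ->
  tendsm (fun k => \adj (Z k)) (\adj A).
Proof.
move=> hZ i j; rewrite mxE.
apply: (@tends_ext (fun k => cofactor (Z k) j i)) => [k|]; first by rewrite mxE.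
apply: tendsM; first exact: tends_cst.
by apply: tends_det => k l; rewrite !mxE; apply: tends_ext (hZ _ _) => q; rewrite !mxE.
Qed.

Lemma ultralimit_mx p q (Z : nat -> 'M[C]_(p, q)) (M : C) :
  (\forall k \near U, forall i j, `|Z k i j| <= M) -> exists L, tendsm Z L.
Proof.
move=> h.
have hl (ij : 'I_p * 'I_q) : exists l, tends (fun k => Z k ij.1 ij.2) l.
  by apply: (@ultralimit _ M); apply: filterS h => k; exact.
have [l hl'] := choice hl.
by exists (\matrix_(i, j) l (i, j)) => i j; rewrite mxE; exact: (hl' (i, j)).
Qed.

End UltraLimits.

(** * Existence of minimisers and of a critical point in the orbit *)

Section Minimisation.
Local Open Scope classical_set_scope.
Variables (R : realType) (m : nat) (nu : bilin R m).
Local Notation C := R[i].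
Local Notation V := 'cV[C]_m.
Local Notation adj := (adjoint (@stdot R m)).
Local Notation nrm2 A := (ip_gl (@stdot R m) A A).
Local Notation ip := (ipV (@stdot R m) (@std_basis R m)).
Local Notation hX := (@std_basis_onb R m).

(** On det P = 1 the inverse is polynomial in the entries, so [gl_act] passes to limits. *)
Lemma invmx_det1 (P : 'M[C]_m) : \det P = 1 -> invmx P = \adj P.
Proof. by move=> h; rewrite /invmx unitmxE h unitr1 invr1 scale1r. Qed.

Lemma nrm2_ge0 (A : 'M[C]_m) : 0 <= nrm2 A.
Proof. exact: (dnorm_ge0 (gl_form hX)). Qed.

Section Limits.
Variable U : set_system nat.
Hypothesis uU : UltraFilter U.

Lemma tendsm_adjoint (Z : nat -> 'M[C]_m) A : tendsm U Z A -> tendsm U (fun k => adj (Z k)) (adj A).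
Proof.
move=> h i j; rewrite adjoint_std.
by apply: tends_ext (tends_conj uU (h j i)) => // k; rewrite adjoint_std.
Qed.

Lemma tends_nrm2 (Z : nat -> 'M[C]_m) A : tendsm U Z A -> tends U (fun k => nrm2 (Z k)) (nrm2 A).
Proof.
move=> h; have := tendsm_mul uU h (tendsm_adjoint h); rewrite /ip_gl => h'.
by apply: tends_sum => i; exact: h'.
Qed.

Lemma tends_stdot (z w : nat -> V) a b : tendsm U z a -> tendsm U w b ->
  tends U (fun k => stdot (z k) (w k)) (stdot a b).
Proof.
by move=> hz hw; apply: tends_sum => i; apply: tendsM => //; apply: tends_conj.
Qed.

Lemma tendsm_bilin (z w : nat -> V) a b : tendsm U z a -> tendsm U w b ->
  tendsm U (fun k => nu (z k) (w k)) (nu a b).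
Proof.
move=> hz hw i j; rewrite (mu_expand nu a b) summxE.
apply: (tends_ext uU) => [k|]; first by rewrite (mu_expand nu (z k)) summxE.
apply: tends_sum => p; rewrite summxE.
apply: (tends_ext uU) => [k|]; first by rewrite summxE.
apply: tends_sum => q; rewrite mxE.
apply: (tends_ext uU) => [k|]; first by rewrite mxE.
by apply: tendsM => //; [apply: tendsM | exact: tends_cst].
Qed.

Lemma tends_ip_act (Z : nat -> 'M[C]_m) P : (forall k, \det (Z k) = 1) -> tendsm U Z P ->
  \det P = 1 /\
  tends U (fun k => ip (gl_act (Z k) nu) (gl_act (Z k) nu)) (ip (gl_act P nu) (gl_act P nu)).
Proof.
move=> dZ hZ.
have dP : \det P = 1.
  apply: (tends_unique uU (tends_det uU hZ)).
  by apply: (tends_ext uU) (tends_cst uU 1) => k; rewrite dZ.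
split; first exact: dP.
rewrite [X in tends U _ X](ipVE hX).
apply: (tends_ext uU) => [k|]; first by rewrite (ipVE hX (gl_act (Z k) nu)).
have hg x y : tendsm U (fun k => gl_act (Z k) nu x y) (gl_act P nu x y).
  rewrite /gl_act (invmx_det1 dP).
  have hA z : tendsm U (fun k => invmx (Z k) *m z) (\adj P *m z : V).
    apply: (tendsm_mul uU) (tendsm_cst uU z) => i j.
    apply: (tends_ext uU) => [k|]; first by rewrite invmx_det1.
    exact: tends_adj.
  by apply: tendsm_mul => //; apply: tendsm_bilin.
by do 2!apply: tends_sum => ?; apply: tends_stdot.
Qed.

End Limits.

Lemma energy_ge0 t P : 0 <= t -> 0 <= energy nu t P.
Proof. by move=> t0; rewrite addr_ge0 ?(ipV_ge0 hX) // mulr_ge0 // nrm2_ge0. Qed.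

Lemma energy0 P : energy nu 0 P = ip (gl_act P nu) (gl_act P nu).
Proof. by rewrite /energy [X in _ + X]mul0r addr0. Qed.

Lemma Re_ge0 (z : C) : 0 <= z -> z = real_complex R (complex.Re z).
Proof. by case: z => x y; rewrite lecE /= => /andP[/eqP -> _]. Qed.

Lemma le_addr1_sqr (x y : C) : 0 <= x -> x ^+ 2 <= y -> x <= 1 + y.
Proof.
move=> x0 h.
have [x1|x1] := real_leP (ger0_real x0) (@real1 C).
  by rewrite (le_trans x1) // lerDl (le_trans _ h) // exprn_ge0.
apply: (@le_trans _ _ (x ^+ 2)); first by rewrite expr2 ler_peMl // ltW.
by rewrite (le_trans h) // lerDr.
Qed.

Lemma exists_ultrafilter : exists U : set_system nat, UltraFilter U /\ \oo `<=` U.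
Proof. exact: ultraFilterLemma. Qed.

Lemma real_inv_tends (U : set_system nat) : \oo `<=` U ->
  forall e : R, 0 < e -> \forall k \near U, `|0 - k.+1%:R^-1| < e.
Proof.
move=> infU e e0; apply: infU.
by have /cvgrPdist_lt /(_ e e0) := @cvg_harmonic R.
Qed.

(** The direct method: a minimising sequence is bounded thanks to the term [t * nrm2 P], and its
    limit keeps determinant 1. *)
Lemma energy_minimiser t : 0 < t -> exists P, \det P = 1 /\
  forall Q, \det Q = 1 -> energy nu t P <= energy nu t Q.
Proof.
move=> t0.
pose E := [set complex.Re (energy nu t Q) | Q in [set Q | \det Q = 1]].
have ReP Q : energy nu t Q = real_complex R (complex.Re (energy nu t Q)).
  by apply: Re_ge0; apply: energy_ge0; exact: ltW.
have hE : has_inf E.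
  split; first by exists (complex.Re (energy nu t 1%:M)), 1%:M => //=; rewrite det1.
  exists 0 => _ [Q _ <-].
  by rewrite -(lecR 0) -ReP energy_ge0 // ltW.
have hP (k : nat) : exists P, \det P = 1 /\ complex.Re (energy nu t P) <= inf E + k.+1%:R^-1.
  have k0 : (0 : R) < k.+1%:R^-1 by rewrite invr_gt0 ltr0n.
  by have [_ [P dP <-] /ltW] := inf_adherent k0 hE; exists P.
have [P hP'] := choice hP.
have [U [uU infU]] := exists_ultrafilter.
have [L hL] : exists L, tendsm U P L.
  pose B := real_complex R (inf E + 1) / t.
  apply: (@ultralimit_mx _ _ uU _ _ _ (1 + B)); apply: nearW => k i j.
  apply: le_addr1_sqr => //; apply: le_trans (nrm2_entry _ i j) _.
  rewrite ler_pdivlMr // mulrC.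
  apply: (@le_trans _ _ (energy nu t (P k))); first by rewrite lerDr (ipV_ge0 hX).
  rewrite ReP lecR (le_trans (hP' k).2) // lerD2l.
  by rewrite invf_le1 ?ltr0n // ler1n.
have [dL hip] := tends_ip_act uU (fun k => (hP' k).1) hL.
exists L; split; [exact: dL | move=> Q dQ].
have h1 : tends U (fun k => energy nu t (P k)) (energy nu t L).
  by apply: tendsD => //; apply: tendsM; [exact: tends_cst | exact: tends_nrm2].
have h2 := tends_real uU (real_inv_tends infU).
have h3 := tendsD uU (tends_cst uU (real_complex R (inf E))) h2.
rewrite rmorph0 addr0 in h3.
have : energy nu t L <= real_complex R (inf E).
  apply: (tends_le uU) h1 h3; apply: nearW => k.
  by rewrite ReP -rmorphD lecR; exact: (hP' k).2.
move=> h; apply: le_trans h _; rewrite ReP lecR.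
by apply: ge_inf; [exact: hE.2 | exists Q].
Qed.


Lemma conj_nneg (t : C) : 0 <= t -> t^* = t.
Proof. by move=> /ger0_real /CrealP. Qed.

(* The first-order condition at [P], paired with [D, D*] for [D = P D0 P^-1]. *)
Lemma minimiser_bound t P D x : 0 < t -> \det P = 1 ->
  (forall Q, \det Q = 1 -> energy nu t P <= energy nu t Q) ->
  derivation D nu ->
  stdot (adj P *m P *m D *m x) (adj P *m P *m D *m x)
    <= nrm2 (P *m D) * stdot (P *m x) (P *m x).
Proof.
move=> t0 dP hmin hD.
have uP : P \in unitmx by rewrite unitmxE dP unitr1.
have [D' D'P] : exists D', D' *m P = P *m D by exists (P *m D *m invmx P); rewrite mulmxKV.
have hD' : derivation D' (gl_bilin P nu).
  have e w : invmx P *m (D' *m w) = D *m (invmx P *m w).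
    by rewrite -[in LHS](mulmxK uP D') D'P -!mulmxA mulKmx.
  apply/derivationP => y z; rewrite !gl_bilinE /gl_act !e mulmxA D'P -mulmxA -mulmxDr.
  by move/derivationP: hD => ->.
(* The squared norm in [energy_derivation] is nonnegative, so the trace of [D', D'*] P P* is at most
   0; the two terms of this trace are |P* D'|^2 and |D' P|^2 = |P D|^2. *)
have hle : nrm2 (adj P *m D') <= nrm2 (P *m D).
  have := energy_derivation (conj_nneg (ltW t0)) uP _ hD'.
  rewrite dP => /(_ hmin) /eqP; rewrite addrC addr_eq0 => /eqP h.
  have : \tr ((D' *m adj D' - adj D' *m D') *m P *m adj P) <= 0.
    rewrite -(pmulr_rle0 _ t0) h oppr_le0; exact: (ipV_ge0 hX).
  rewrite !mulmxBl mxtraceB subr_le0.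
  have -> : \tr (D' *m adj D' *m P *m adj P) = nrm2 (adj P *m D').
    by rewrite /ip_gl (adjointM hX) (adjointK hX) mxtrace_mulC !mulmxA.
  have -> : \tr (adj D' *m D' *m P *m adj P) = nrm2 (P *m D).
    by rewrite -D'P /ip_gl (adjointM hX) mulmxA [RHS]mxtrace_mulC !mulmxA.
  by [].
have -> : adj P *m P *m D *m x = adj P *m D' *m (P *m x).
  by rewrite -!mulmxA [D' *m _]mulmxA D'P -!mulmxA.
apply: le_trans (nrm2_mulmx _ _) _.
by apply: ler_wpM2r => //; exact: dnorm_ge0.
Qed.

(** Irreducibility under derivations is applied to one subspace, the kernel of the limit [L] of the
    normalised minimisers. *)
Lemma exists_critical_point :
  (0 < m)%N ->
  (forall W : {vspace V}, (forall D, derivation D nu -> forall w, w \in W -> D *m w \in W) ->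
     W = 0%VS \/ W = fullv) ->
  exists2 P, P \in unitmx &
    forall D, derivation D (gl_bilin P nu) -> derivation (adj D) (gl_bilin P nu).
Proof.
move=> m0 irr.
pose t k : C := real_complex R k.+1%:R^-1.
have t0 k : 0 < t k by rewrite ltcR invr_gt0 ltr0n.
have [P hP] := choice (fun k => energy_minimiser (t0 k)).
have dP k := (hP k).1; have minP k := (hP k).2.
have [U [uU infU]] := exists_ultrafilter.
have tU : tends U t 0.
  by have := tends_real uU (real_inv_tends infU); rewrite rmorph0.
pose r k := sqrtC (nrm2 (P k)).
have r0 k : 0 < r k.
  rewrite sqrtC_gt0 lt_def nrm2_ge0 andbT; apply/eqP => /(ip_gl_eq0 hX) h.
  have uP : P k \in unitmx by rewrite unitmxE dP unitr1.
  have := mulmxV uP; rewrite h mul0mx => /matrixP /(_ (Ordinal m0) (Ordinal m0)).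
  by rewrite !mxE eqxx => /eqP; rewrite eq_sym oner_eq0.
have rr k : r k * (r k)^* = nrm2 (P k).
  by rewrite conj_nneg ?ltW // -expr2 sqrtCK.
(* Normalised to norm 1, because nothing yet bounds [P k] as [t k] tends to 0. *)
pose S k := (r k)^-1 *: P k.
have PS k : P k = r k *: S k by rewrite scalerA mulfV ?scale1r // gt_eqF.
have nrm2Z a (A : 'M[C]_m) : nrm2 (a *: A) = a * a^* * nrm2 A.
  by rewrite /ip_gl (adjointZ hX) -scalemxAl -scalemxAr scalerA mxtraceZ.
clearbody S r.
have rc k : (r k)^* = r k by rewrite conj_nneg // ltW.
have nS k : nrm2 (S k) = 1.
  have n0 : r k * (r k)^* != 0 by rewrite rc mulf_neq0 // gt_eqF.
  by apply: (mulfI n0); rewrite -nrm2Z -PS mulr1 rr.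
have stdotZ a (y : V) : stdot (a *: y) (a *: y) = a * a^* * stdot y y.
  by rewrite linearZl_LR linearZr_LR /= mulrA.
(* Both sides of [minimiser_bound] have degree 4 in [P], so the factor [r k] cancels. *)
have bS k D x : derivation D nu ->
  stdot (adj (S k) *m S k *m D *m x) (adj (S k) *m S k *m D *m x)
    <= nrm2 (S k *m D) * stdot (S k *m x) (S k *m x).
  move=> hD; have := minimiser_bound x (t0 k) (dP k) (minP k) hD.
  have -> : adj (P k) *m P k *m D *m x = (r k * r k) *: (adj (S k) *m S k *m D *m x).
    by rewrite PS (adjointZ hX) rc -scalemxAr -!scalemxAl scalerA.
  have -> : P k *m x = r k *: (S k *m x) by rewrite PS scalemxAl.
  have -> : P k *m D = r k *: (S k *m D) by rewrite PS scalemxAl.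
  rewrite !stdotZ nrm2Z rmorphM /= rc [leRHS]mulrACA ler_pM2l //.
  by rewrite !mulr_gt0.
have [L hL] : exists L, tendsm U S L.
  apply: (@ultralimit_mx _ _ uU _ _ _ (1 + 1)); apply: nearW => k i j.
  by apply: le_addr1_sqr => //; rewrite -(nS k) nrm2_entry.
have nL : nrm2 L = 1.
  apply: (tends_unique uU (tends_nrm2 uU hL)).
  by apply: (tends_ext uU) (tends_cst uU 1) => k; rewrite nS.
have bL D x : derivation D nu ->
  stdot (adj L *m L *m D *m x) (adj L *m L *m D *m x)
    <= nrm2 (L *m D) * stdot (L *m x) (L *m x).
  move=> hD.
  have hLm q (B : 'M_(m, q)) := tendsm_mul uU hL (tendsm_cst uU B).
  have hz : tendsm U (fun k => adj (S k) *m S k *m D *m x) (adj L *m L *m D *m x).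
    do 2![apply: (tendsm_mul uU) (tendsm_cst uU _)].
    exact: (tendsm_mul uU (tendsm_adjoint uU hL) hL).
  apply: (tends_le uU) (tends_stdot uU hz hz)
    (tendsM uU (tends_nrm2 uU (hLm _ D)) (tends_stdot uU (hLm _ x) (hLm _ x))).
  by apply: nearW => k; exact: bS.
(* If L w = 0, the bound gives L* L D w = 0, hence L D w = 0: the kernel is stable under
   derivations. It is not the whole space because [L] has norm 1, so it is 0. *)
have dL : \det L != 0.
  pose f := linfun (mulmx L : V -> V).
  have kerP x : (x \in lker f) = (L *m x == 0) by rewrite memv_ker lfunE.
  have [|k0|kf] := irr (lker f).
  - move=> D hD w; rewrite !kerP => /eqP w0.
    have := bL D w hD; rewrite w0 linear0r mulr0 => h.
    have {h}h : adj L *m L *m D *m w = 0.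
      by apply/eqP; rewrite -(dnorm_eq0 (@stdot R m)) eq_le h dnorm_ge0.
    have : stdot (L *m (D *m w)) (L *m (D *m w)) = stdot (D *m w) (adj L *m (L *m (D *m w))).
      exact: (adjointP hX).
    by rewrite !mulmxA h linear0r => /eqP; rewrite (dnorm_eq0 (@stdot R m)).
  - rewrite -unitfE -unitmxE -unitmx_tr -row_free_unit; apply: inj_row_free => v hv.
    apply: trmx_inj; rewrite trmx0; apply/eqP; rewrite -memv0 -k0 kerP.
    by rewrite -[L]trmxK -trmx_mul hv trmx0.
  have L0 : L = 0.
    apply: mulmx_inj => y; rewrite mul0mx; apply/eqP.
    by rewrite -kerP kf memvf.
  by move: nL; rewrite L0 /ip_gl mul0mx mxtrace0 => /eqP; rewrite eq_sym oner_eq0.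
(* 1 = det P_k = r_k^m det S_k, and det S_k stays away from 0 since its limit det L is nonzero. *)
have [K hK] : exists K, \forall k \near U, r k <= K.
  have l0 : 0 < `|\det L| / 2 by rewrite divr_gt0 ?normr_gt0 ?ltr0n.
  exists (1 + (`|\det L| / 2)^-1); apply: filterS (tends_det uU hL l0) => k hk.
  have h1 : `|\det L| / 2 < `|\det (S k)|.
    rewrite -(ltrD2l (`|\det L| / 2)) -splitr -[\det L in ltLHS](subrK (\det (S k))).
    by rewrite (le_lt_trans (ler_normD _ _)) // ltrD2r.
  have h2 : r k ^+ m * `|\det (S k)| = 1.
    have := dP k; rewrite PS detZ => /(congr1 Num.norm).
    by rewrite normrM normrX normr1 gtr0_norm.
  have h3 : r k ^+ m <= (`|\det L| / 2)^-1.
    by rewrite -[leRHS]mul1r ler_pdivlMr // -[leRHS]h2 ler_pM2l ?exprn_gt0 // ltW.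
  have [x1|x1] := real_leP (ger0_real (ltW (r0 k))) (@real1 C).
    by rewrite (le_trans x1) // lerDl invr_ge0 ltW.
  rewrite (@le_trans _ _ (r k ^+ m)) //; last by rewrite (le_trans h3) // lerDr.
  by rewrite ler_eXnr // ltW.
have [Q hQ] : exists Q, tendsm U P Q.
  apply: (@ultralimit_mx _ _ uU _ _ _ (1 + K ^+ 2)); apply: filterS hK => k hk i j.
  apply: le_addr1_sqr => //; apply: le_trans (nrm2_entry _ i j) _.
  by rewrite -rr rc expr2 ler_pM // ltW.
have [dQ hip] := tends_ip_act uU dP hQ.
have uQ : Q \in unitmx by rewrite unitmxE dQ unitr1.
exists Q; [exact: uQ | move=> D hD].
(* As [t k] tends to 0 the penalty disappears, so [Q] minimises |T.nu|^2 itself. With t = 0,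
   [energy_derivation] then says that the adjoint of [D] acts by 0. *)
have minQ T : \det T = \det Q -> energy nu 0 Q <= energy nu 0 T.
  rewrite dQ => dT.
  rewrite !energy0.
  have hT := tendsD uU (tends_cst uU (ip (gl_act T nu) (gl_act T nu)))
    (tendsM uU tU (tends_cst uU (nrm2 T))).
  rewrite mul0r addr0 in hT.
  apply: (tends_le uU _ hip hT); apply: nearW => k.
  apply: (@le_trans _ _ (energy nu (t k) (P k))).
    by rewrite lerDl; apply: mulr_ge0; [exact: ltW | exact: nrm2_ge0].
  exact: (minP k T dT).
have := energy_derivation (conj_nneg (lexx 0)) uQ minQ hD.
by rewrite mul0r addr0 => /(ipV_eq0 hX).
Qed.

End Minimisation.

(** * Star operations and the points of scalar moment map they produce *)

Section StarStructure.
Variables (R : realType) (n : nat).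
Local Notation C := R[i].
Local Notation V := 'cV[C]_n.

Lemma exists_orthonormal_basis (h : herm_prod R n) : exists Y, orthonormal_basis h Y.
Proof.
have [s so sn] : exists2 s : seq V, orthonormal h s & size s = n.
  suff : forall k, (k <= n)%N -> exists2 s : seq V, orthonormal h s & size s = k.
    by apply.
  elim=> [|k IH] kn; first by exists [::].
  have [s so sk] := IH (ltnW kn).
  have [v hv] : exists v, v \notin <<s>>%VS.
    apply: contrapT => no.
    have : (dim V <= size s)%N.
      rewrite -dimvf (leq_trans _ (dim_span s)) // dimvS //.
      by apply/subvP => v _; apply: contrapT => /negP hv; apply: no; exists v.
    by rewrite dim_matrix mulr1 sk leqNgt kn.
  have [Z hZ [Y [vE _ oY]]] := orthogonal_split h s v.
  have Y0 : Y != 0 by apply: contra hv => /eqP Y0; rewrite vE Y0 addr0.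
  have hY : 0 < h Y Y by rewrite dnorm_gt0.
  pose a := (sqrtC (h Y Y))^-1.
  have a0 : 0 < a by rewrite invr_gt0 sqrtC_gt0.
  have ra : a^* = a by apply/CrealP/ger0_real/ltW.
  exists (a *: Y :: s); last by rewrite /= sk.
  rewrite -cat1s orthonormal_cat so /=; apply/andP; split.
    apply/orthonormalP; split=> // _ _ /[!inE] /eqP -> /eqP ->; rewrite eqxx.
    rewrite linearZl_LR linearZr_LR /= ra mulrA -expr2.
    by rewrite /a exprVn sqrtCK mulVf // gt_eqF.
  apply/orthoPl => w ws; rewrite linearZl_LR /=.
  by move/orthoPl: oY => ->; rewrite ?mulr0.
exists (fun i => nth 0 s i) => i j.
have [us ->] := (orthonormalP so); rewrite ?mem_nth ?sn //.
by rewrite nth_uniq ?sn.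
Qed.

(* [tau] plays the part of the adjoint map [ad x |-> (ad x)^*] of a compact real form. *)
Record star (mu : bilin R n) (U : {vspace V}) (tau : V -> V) : Prop := Star {
  star_lin : forall a x y, tau (a *: x + y) = a^* *: tau x + tau y;
  star_in : forall x, x \in U -> tau x \in U;
  starK : forall x, x \in U -> tau (tau x) = x;
  star_bracket : forall x y, x \in U -> y \in U -> tau (mu x y) = mu (tau y) (tau x);
  star_pos : forall x, x \in U -> x != 0 -> 0 < \tr (lop mu x *m lop mu (tau x)) }.

(** Here a, b, s, t stand for h(x, x), h(y, y), h(x, y), h(y, x), and primes for conjugates. The
    hypotheses say that h is real on the diagonal at x + y and at x + iy. *)
Fact polarization (F : comNzRingType) (i a b s t s' t' : F) :
  a + s' + (t' + b) = a + s + (t + b) ->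
  a + - - i * s' + (- i * t' + - i * (- - i * b)) = a + - i * s + (i * t + i * (- i * b)) ->
  2 * i * (s - t') = 0.
Proof.
move=> e1 e2.
have -> : 2 * i * (s - t') = i * ((a + s + (t + b)) - (a + s' + (t' + b)))
    - ((a + - i * s + (i * t + i * (- i * b)))
       - (a + - - i * s' + (- i * t' + - i * (- - i * b)))) by ring.
by rewrite e1 e2 !subrr mulr0 subr0.
Qed.

Section TraceForm.
Variables (mu : bilin R n) (tau : V -> V).
Hypothesis htau : star mu fullv tau.

Definition trace_form of star mu fullv tau := fun x y => \tr (lop mu x *m lop mu (tau y)).

Fact trace_form_bilinear : bilinear_for *%R (@Num.conj C \; *%R) (trace_form htau).
Proof.
split=> x a u v; rewrite /trace_form.
  by rewrite linearP mulmxDl -scalemxAl mxtraceD mxtraceZ.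
by rewrite (star_lin htau) linearP mulmxDr -scalemxAr mxtraceD mxtraceZ.
Qed.

HB.instance Definition _ := bilinear_isBilinear.Build C V V C
  *%R (@Num.conj C \; *%R) (trace_form htau) trace_form_bilinear.

Fact trace_form_gt0 x : x != 0 -> 0 < trace_form htau x x.
Proof. by apply: (star_pos htau); exact: memvf. Qed.

(** Positivity makes the form real on the diagonal, and polarisation then gives the symmetry, which
    is not a field of [star]. *)
Fact trace_form_hermitian x y : trace_form htau x y = (-1) ^+ false * (trace_form htau y x)^*.
Proof.
rewrite expr0 mul1r.
have re z : (trace_form htau z z)^* = trace_form htau z z.
  have [->|/trace_form_gt0 z0] := eqVneq z 0; first by rewrite linear0l conjC0.
  by apply/CrealP/ger0_real/ltW.
have h1 := re (x + y); have h2 := re (x + 'i *: y).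
move: h1 h2; rewrite !(linearDl, linearDr, linearZl_LR, linearZr_LR) /=.
set s := trace_form htau x y; set t := trace_form htau y x.
rewrite !rmorphD !rmorphM /= !re conjCi ?rmorphN /= ?conjCi.
move: (trace_form htau x x) (trace_form htau y y) => a b e1 e2.
have := polarization e1 e2; move/eqP; rewrite mulf_eq0 subr_eq0.
by rewrite mulf_eq0 (negPf (neq0Ci C)) pnatr_eq0 => /eqP.
Qed.

HB.instance Definition _ := isHermitianSesquilinear.Build C V
  false (@Num.conj C) (trace_form htau) trace_form_hermitian.

HB.instance Definition _ := isDotProduct.Build C V (trace_form htau) trace_form_gt0.

(** [g] sends a basis [Y], orthonormal for the trace form, to [X]. *)
Lemma exists_isometry (dot : herm_prod R n) X : orthonormal_basis dot X ->
  exists2 g : 'M[C]_n, g \in unitmx &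
    forall x y, dot (g *m x) (g *m y) = \tr (lop mu x *m lop mu (tau y)).
Proof.
move=> hX; have [Y hY] := exists_orthonormal_basis (trace_form htau).
pose g : 'M[C]_n := \matrix_(i, j) (\sum_k trace_form htau (delta_mx j 0) (Y k) *: X k) i 0.
have gE x : g *m x = \sum_k trace_form htau x (Y k) *: X k.
  apply/colP => i; rewrite mxE summxE.
  under eq_bigr => j _ do rewrite mxE summxE mulr_suml.
  rewrite exchange_big; apply: eq_bigr => k _ /=.
  rewrite mxE [in RHS](cV_sum x) linear_sumlz mulr_suml; apply: eq_bigr => j _.
  by rewrite linearZl_LR /= !mxE mulrC mulrA.
have gX x k : dot (g *m x) (X k) = trace_form htau x (Y k).
  rewrite gE (dot_suml dot) (bigD1 k) //= big1 => [|l lk]; rewrite (dotZl dot) hX.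
    by rewrite eqxx mulr1 addr0.
  by rewrite (negPf lk) mulr0.
have iso x y : dot (g *m x) (g *m y) = trace_form htau x y.
  rewrite -(parseval hX) -(parseval hY); apply: eq_bigr => k _.
  by rewrite !gX.
exists g; last exact: iso.
rewrite -unitmx_tr -row_free_unit; apply: inj_row_free => v hv.
apply: trmx_inj; rewrite trmx0; apply/eqP/negPn/negP => /trace_form_gt0.
by rewrite -iso -[g]trmxK -trmx_mul hv trmx0 linear0l ltxx.
Qed.

End TraceForm.

Section Moment.
Variables (dot : herm_prod R n) (X : 'I_n -> V).
Hypothesis hX : orthonormal_basis dot X.
Variables (mu : bilin R n) (tau : V -> V).
Hypotheses (lie : lie_algebra mu) (htau : star mu fullv tau).
Local Notation adj := (adjoint dot).

Section Invariant.
Hypothesis dotE : forall x y, dot x y = \tr (lop mu x *m lop mu (tau y)).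

Lemma lop_bracket x y : lop mu (mu x y) = lop mu x *m lop mu y - lop mu y *m lop mu x.
Proof.
rewrite derivation_lop ?lopE //; apply: derivation_lopP; exact: lie_leibniz.
Qed.

Lemma adjoint_lop z : adj (lop mu z) = lop mu (tau z).
Proof.
apply: (adjoint_unique) => x y; rewrite !lopE !dotE.
rewrite (star_bracket htau) ?memvf // (starK htau) ?memvf // !lop_bracket.
move: (lop mu z) (lop mu x) (lop mu (tau y)) => a b c.
rewrite mulmxBl mulmxBr !mxtraceB; congr (_ - _).
  by rewrite -mulmxA mxtrace_mulC mulmxA.
by rewrite -mulmxA.
Qed.

(** The Casimir operator of the adjoint representation. Pairing it with z and y gives the sum of
    <[Y_i, z], [Y_i, y]>, which by anticommutativity is the trace of L_z L_y*, that is, <z, y>. *)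
Lemma sum_adjoint_lop Y : orthonormal_basis dot Y ->
  \sum_i adj (lop mu (Y i)) *m lop mu (Y i) = 1%:M.
Proof.
move=> hY; apply: mulmx_inj => y; apply/eqP; rewrite -subr_eq0; apply/eqP.
apply: (dot_eq0 (dot := dot)) => z.
rewrite mul1mx (dotBr dot) mulmx_suml (dot_sumr dot); apply/eqP; rewrite subr_eq0; apply/eqP.
transitivity (\tr (lop mu z *m adj (lop mu y))); last by rewrite adjoint_lop -dotE.
rewrite mxtrace_mulC (tr_onb hY); apply: eq_bigr => i _.
rewrite -!mulmxA (adjointP' hX) -(adjointP hX) !lopE.
have anti := alternating_anticomm lie.1.
by rewrite [mu (Y i) z]anti [mu (Y i) y]anti linearNl linearNr /= opprK.
Qed.

(** Each of the three sums is the identity, whence 2 - 2 - 2. The first is the Casimir sum over the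
    orthonormal basis [tau \o X], and in the third [rop] is minus [lop]. *)
Lemma Mop_star : Mop dot X mu = (- 2)%:M.
Proof.
have hY : orthonormal_basis dot (tau \o X).
  move=> i j /=; rewrite dotE (starK htau) ?memvf // mxtrace_mulC -dotE hX eq_sym //.
rewrite /Mop.
have -> : \sum_i lop mu (X i) *m adj (lop mu (X i)) = 1%:M.
  rewrite -(sum_adjoint_lop hY); apply: eq_bigr => i _ /=.
  by rewrite !adjoint_lop (starK htau) ?memvf.
have -> : \sum_i adj (rop mu (X i)) *m rop mu (X i) = 1%:M.
  rewrite -(sum_adjoint_lop hX); apply: eq_bigr => i _.
  have -> : rop mu (X i) = - lop mu (X i).
    apply: mulmx_inj => y; rewrite ropE mulNmx lopE.
    exact: (alternating_anticomm lie.1).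
  by rewrite (adjointN hX) mulNmx mulmxN opprK.
by rewrite (sum_adjoint_lop hX) subrr sub0r scale_scalar_mx mulr1 raddfN.
Qed.

End Invariant.
End Moment.

(** Moving along the isometry [g] carries the star operation over and turns the trace form into the
    fixed product [dot], where [Mop_star] applies. *)
Lemma star_minimal (dot : herm_prod R n) X (mu : bilin R n) tau :
  orthonormal_basis dot X -> lie_algebra mu -> star mu fullv tau ->
  exists2 g : 'M[C]_n, g \in unitmx & exists a, moment dot X (gl_bilin g mu) = a%:M.
Proof.
move=> hX lie htau; have [g ug iso] := exists_isometry htau hX.
exists g => //.
pose lam := gl_bilin g mu; pose tau' x := g *m tau (invmx g *m x).
have lamE x y : lam x y = g *m mu (invmx g *m x) (invmx g *m y) by [].
have lopl x : lop lam x = g *m lop mu (invmx g *m x) *m invmx g.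
  by apply: mulmx_inj => y; rewrite lopE -!mulmxA lopE.
have lie' : lie_algebra lam.
  split=> [x|x y z]; first by rewrite lamE lie.1 mulmx0.
  by rewrite !lamE !mulKmx // -!mulmxDr lie.2 mulmx0.
have trE x y : \tr (lop lam x *m lop lam (tau' y)) =
    \tr (lop mu (invmx g *m x) *m lop mu (tau (invmx g *m y))).
  rewrite !lopl /tau' mulKmx // -!mulmxA mxtrace_mulC -!mulmxA.
  by rewrite mulVmx // mulmx1 mulKmx // mulmxA.
have hs : star lam fullv tau'.
  split=> [a x y|x _|x _|x y _ _|x _ x0]; rewrite ?memvf //.
  - by rewrite /tau' mulmxDr -scalemxAr (star_lin htau) mulmxDr -scalemxAr.
  - by rewrite /tau' mulKmx // (starK htau) ?memvf // mulKVmx.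
  - by rewrite /tau' !lamE !mulKmx // (star_bracket htau) ?memvf.
  rewrite trE; apply: (star_pos htau); rewrite ?memvf //.
  by apply: contra x0 => /eqP h; rewrite -(mulKVmx ug x) h mulmx0.
have dE x y : dot x y = \tr (lop lam x *m lop lam (tau' y)).
  by rewrite trE -iso !mulKVmx.
exists ((ipV dot X lam lam)^-1 * - 2).
by rewrite (momentE hX) (Mop_star hX lie' hs dE) scale_scalar_mx.
Qed.

End StarStructure.

(** * Splitting off minimal ideals and building a star operation by induction *)

Section Decomposition.
Variables (R : realType) (n : nat) (mu : bilin R n).
Local Notation C := R[i].
Local Notation V := 'cV[C]_n.
Hypotheses (lie : lie_algebra mu) (triv : abelian_ideals_trivial mu).
Implicit Types U I J : {vspace V}.

Let lei : leibniz mu := lie_leibniz lie.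
Let anti := alternating_anticomm lie.1.

Lemma ideal_left U : (forall x y, y \in U -> mu x y \in U) -> ideal mu U.
Proof. by move=> h x y yU; split; [exact: h | rewrite anti rpredN; exact: h]. Qed.

Lemma ideal_memr U x y : ideal mu U -> y \in U -> mu x y \in U.
Proof. by move=> hU /(hU x)[]. Qed.

Lemma ideal_meml U x y : ideal mu U -> y \in U -> mu y x \in U.
Proof. by move=> hU /(hU x)[]. Qed.

Lemma ideal_cap U J : ideal mu U -> ideal mu J -> ideal mu (U :&: J)%VS.
Proof.
move=> hU hJ x y; rewrite memv_cap => /andP[yU yJ].
have [[u1 u2] [j1 j2]] := (hU x y yU, hJ x y yJ).
by rewrite !memv_cap u1 u2 j1 j2.
Qed.

Definition centraliser I : {vspace V} :=
  (\bigcap_(i < \dim I) lker (linfun (mulmx (rop mu (vbasis I)`_i) : V -> V)))%VS.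

Lemma centraliserP I x :
  reflect (forall y, y \in I -> mu x y = 0) (x \in centraliser I).
Proof.
rewrite memvE; apply: (iffP subv_bigcapP) => [h y /coord_vbasis ->|h i _].
  rewrite linear_sumr big1 // => i _; rewrite linearZr_LR.
  have := h i isT; rewrite -memvE memv_ker lfunE /= ropE => /eqP ->.
  by rewrite scaler0.
by rewrite -memvE memv_ker lfunE /= ropE h // vbasis_mem // mem_nth // size_tuple.
Qed.

Lemma ideal_centraliser I : ideal mu I -> ideal mu (centraliser I).
Proof.
move=> hI; apply: ideal_left => x c /centraliserP hc; apply/centraliserP => y yI.
have := lei x c y; rewrite hc // linear0r hc ?(hI x y yI).1 // addr0 => <- //.
Qed.

Lemma cap_centraliser I : ideal mu I -> (I :&: centraliser I)%VS = 0%VS.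
Proof.
move=> hI; apply: triv; first exact: ideal_cap (ideal_centraliser hI).
by move=> x y; rewrite !memv_cap => /andP[_ /centraliserP h] /andP[yI _]; apply: h.
Qed.

Lemma minimal_ideal U : ideal mu U -> U != 0%VS -> exists I,
  [/\ ideal mu I, (I <= U)%VS, I != 0%VS &
      forall J, ideal mu J -> (J <= I)%VS -> J = 0%VS \/ J = I].
Proof.
move: {2}(\dim U) (leqnn (\dim U)) => d; elim: d U => [|d IH] U.
  by rewrite leqn0 dimv_eq0 => /eqP ->; rewrite eqxx.
move=> dU hU U0.
have [[J [hJ JU J0 JnU]]|no] := pselect (exists J,
    [/\ ideal mu J, (J <= U)%VS, J != 0%VS & J != U]).
  have [|I [hI IJ I0 minI]] := IH J _ hJ J0.
    rewrite -ltnS (leq_trans _ dU) // ltn_neqAle dimvS // andbT.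
    by apply: contra JnU => /eqP dJ; rewrite eqEdim JU dJ leqnn.
  by exists I; split=> //; exact: subv_trans JU.
exists U; split=> // J hJ JU; have [->|J0] := eqVneq J 0%VS; first by left.
by right; apply: contrapT => /eqP JnU; apply: no; exists J.
Qed.

(** [B] parametrises [I] and [A] reads off coordinates; this turns an ideal into an algebra on
    C^m. *)
Record frame m I (A : 'M[C]_(m, n)) (B : 'M[C]_(n, m)) : Prop := Frame {
  frameK : A *m B = 1%:M;
  frame_in : forall u, B *m u \in I;
  frame_id : forall x, x \in I -> B *m (A *m x) = x }.

Lemma exists_frame I : exists A B, @frame (\dim I) I A B.
Proof.
pose b := vbasis I.
have hb := basis_free (vbasisP I).
pose B : 'M[C]_(n, \dim I) := \matrix_(i, j) b`_j i 0.
pose A : 'M[C]_(\dim I, n) := \matrix_(j, i) coord b j (delta_mx i 0).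
have BE u : B *m u = \sum_j u j 0 *: b`_j.
  apply/colP => i; rewrite mxE summxE; apply: eq_bigr => j _.
  by rewrite !mxE mulrC.
have AE x j : (A *m x) j 0 = coord b j x.
  rewrite mxE [in RHS](cV_sum x) linear_sum /=; apply: eq_bigr => i _.
  by rewrite linearZ /= !mxE mulrC.
exists A, B; split=> [|u|x xI].
- apply: mulmx_inj => u; apply/colP => j.
  by rewrite mul1mx -mulmxA AE BE coord_sum_free.
- rewrite BE rpred_sum // => j _; rewrite rpredZ // vbasis_mem // mem_nth //.
  by rewrite size_tuple.
rewrite BE [RHS](coord_vbasis xI); apply: eq_bigr => j _.
by rewrite AE.
Qed.

Section IdealAlgebra.
Variables (m : nat) (I : {vspace V}) (A : 'M[C]_(m, n)) (B : 'M[C]_(n, m)).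
Hypotheses (hI : ideal mu I) (fAB : frame I A B).
Local Notation nu := (pushpull A B mu : bilin R m).

Lemma frame_inj (u v : 'cV[C]_m) : B *m u = B *m v -> u = v.
Proof. by move=> /(congr1 (mulmx A)); rewrite !mulmxA (frameK fAB) !mul1mx. Qed.

Lemma frameE u v : B *m nu u v = mu (B *m u) (B *m v).
Proof.
rewrite /= /pushpull (frame_id fAB) //; apply: (ideal_memr _ hI).
exact: (frame_in fAB).
Qed.

Definition restr x := A *m lop mu x *m B.

Lemma restrE x u : B *m (restr x *m u) = mu x (B *m u).
Proof.
rewrite /restr -!mulmxA lopE (frame_id fAB) //.
by apply: (ideal_memr _ hI); exact: (frame_in fAB).
Qed.

Lemma derivation_restr x : derivation (restr x) nu.
Proof.
apply/derivationP => u v; apply: frame_inj.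
by rewrite mulmxDr !frameE !restrE frameE lei.
Qed.

Lemma leibniz_frame : leibniz nu.
Proof. by move=> u v w; apply: frame_inj; rewrite mulmxDr !frameE lei. Qed.

Lemma lop_frame u : lop nu u = restr (B *m u).
Proof.
by apply: mulmx_inj => v; rewrite lopE; apply: frame_inj; rewrite frameE restrE.
Qed.

Lemma restr_eq0 x : restr x = 0 -> x \in centraliser I.
Proof.
move=> h; apply/centraliserP => y yI.
by rewrite -(frame_id fAB yI) -restrE h mul0mx mulmx0.
Qed.

Lemma lop_frame_inj u : lop nu u = 0 -> u = 0.
Proof.
rewrite lop_frame => /restr_eq0 h; apply: frame_inj; rewrite mulmx0; apply/eqP.
by rewrite -memv0 -(cap_centraliser hI) memv_cap h (frame_in fAB).
Qed.

(** The product of the two operators maps everything into the ideal, so its trace is that of its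
    restriction. *)
Lemma tr_frame u v : \tr (lop mu (B *m u) *m lop mu (B *m v)) = \tr (lop nu u *m lop nu v).
Proof.
have -> : lop mu (B *m u) *m lop mu (B *m v) = B *m (A *m (lop mu (B *m u) *m lop mu (B *m v))).
  apply: mulmx_inj => x; rewrite -!mulmxA (frame_id fAB) //.
  rewrite !lopE; apply: (ideal_meml _ hI); exact: (frame_in fAB).
rewrite mxtrace_mulC; congr (\tr _); apply: mulmx_inj => w; apply: frame_inj.
rewrite -!mulmxA !lopE !frameE (frame_id fAB) //.
by apply: (ideal_memr _ hI); apply: (ideal_memr _ hI); exact: (frame_in fAB).
Qed.

End IdealAlgebra.

Lemma frame_unit m I A B (P : 'M[C]_m) : @frame m I A B -> P \in unitmx ->
  frame I (P *m A) (B *m invmx P).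
Proof.
move=> f uP; split=> [|u|x xI].
- by rewrite -mulmxA [A *m _]mulmxA (frameK f) mul1mx mulmxV.
- by rewrite -mulmxA (frame_in f).
by rewrite -!mulmxA mulKmx // (frame_id f).
Qed.

(** Every element of the whole algebra acts on [I] by a derivation, so a subspace of [I] stable
    under derivations is an ideal of the whole algebra, and minimality gives the irreducibility
    needed. The change of coordinates [P] is absorbed in the frame. *)
Lemma minimal_ideal_frame I : ideal mu I -> I != 0%VS ->
  (forall J, ideal mu J -> (J <= I)%VS -> J = 0%VS \/ J = I) ->
  exists m, exists A : 'M[C]_(m, n), exists2 B, frame I A B &
    forall D, derivation D (pushpull A B mu) ->
      derivation (adjoint (@stdot R m) D) (pushpull A B mu).
Proof.
move=> hI I0 minI; have [A [B fAB]] := exists_frame I.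
have m0 : (0 < \dim I)%N by rewrite lt0n dimv_eq0.
pose f := linfun (mulmx B : 'cV[C]_(\dim I) -> V).
have fE u : f u = B *m u by rewrite lfunE.
have [W hW|P uP hP] := @exists_critical_point R _ (pushpull A B mu) m0.
  have JI : (f @: W <= I)%VS.
    by apply/subvP => _ /memv_imgP[w _ ->]; rewrite fE (frame_in fAB).
  have hJ : ideal mu (f @: W)%VS.
    apply: ideal_left => x _ /memv_imgP[w wW ->].
    rewrite fE -(restrE hI fAB) -fE memv_img // hW //.
    exact: (derivation_restr hI fAB).
  have [J0|J1] := minI _ hJ JI; [left|right].
    apply/eqP; rewrite -subv0; apply/subvP => w wW; rewrite memv0; apply/eqP.
    apply: (frame_inj fAB); rewrite mulmx0 -fE; apply/eqP.
    by rewrite -memv0 -J0 memv_img.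
  apply/vspaceP => w; rewrite memvf.
  have : B *m w \in (f @: W)%VS by rewrite J1 (frame_in fAB).
  by move=> /memv_imgP[w' w'W]; rewrite fE => /(frame_inj fAB) ->.
exists (\dim I), (P *m A), (B *m invmx P); first exact: frame_unit.
have e D : derivation D (pushpull (P *m A) (B *m invmx P) mu) <->
    derivation D (gl_bilin P (pushpull A B mu)).
  by split=> h u v; have := h u v; rewrite !actE /= /pushpull !mulmxA.
by move=> D hD; exact: (proj2 (e _) (hP _ (proj1 (e _) hD))).
Qed.

(** Derivations of [I] are inner and closed under adjoints. So the adjoint of each ad u is some ad
    (s u), which defines the star operation, and each x acts on [I] like some y in [I], so that x -
    y centralises [I]. *)
Lemma minimal_ideal_star I : ideal mu I -> I != 0%VS ->
  (forall J, ideal mu J -> (J <= I)%VS -> J = 0%VS \/ J = I) ->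
  (exists tau, star mu I tau) /\
  forall x, exists y, y \in I /\ x - y \in centraliser I.
Proof.
move=> hI I0 minI; have [m [A [B fAB hder]]] := minimal_ideal_frame hI I0 minI.
set nu := pushpull A B mu in hder.
pose adj := adjoint (@stdot R m).
have linj := lop_frame_inj hI fAB.
have inner := derivation_inner (@std_basis_onb R m) (leibniz_frame hI fAB) linj hder.
have lop_inj u v : lop nu u = lop nu v -> u = v.
  move=> /eqP; rewrite -subr_eq0 -linearB => /eqP /linj /eqP.
  by rewrite subr_eq0 => /eqP.
split; last first.
  move=> x; have [u hu] := inner _ (derivation_restr hI fAB x).
  exists (B *m u); split; first exact: (frame_in fAB).
  apply: (restr_eq0 hI fAB); rewrite /restr linearB mulmxBr mulmxBl -!/(restr _ _ _).
  by rewrite -(lop_frame hI fAB) -hu subrr.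
have [s hs] := choice (fun u => inner _ (hder _ (derivation_lopP u (leibniz_frame hI fAB)))).
have sK u : s (s u) = u.
  by apply: lop_inj; rewrite -!hs (adjointK (@std_basis_onb R m)).
have slin a u v : s (a *: u + v) = a^* *: s u + s v.
  apply: lop_inj; rewrite -hs !linearP /= -!hs.
  by rewrite (adjointD (@std_basis_onb R m)) (adjointZ (@std_basis_onb R m)).
have sbr u v : s (nu u v) = nu (s v) (s u).
  have br w w' : lop nu (nu w w') = lop nu w *m lop nu w' - lop nu w' *m lop nu w.
    rewrite derivation_lop ?lopE //; apply: derivation_lopP; exact: leibniz_frame hI fAB.
  apply: lop_inj; rewrite -hs !br -!hs (adjointB (@std_basis_onb R m)).
  by rewrite !(adjointM (@std_basis_onb R m)).
have AB u : A *m (B *m u) = u by rewrite mulmxA (frameK fAB) mul1mx.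
exists (fun x => B *m s (A *m x)); split=> [a x y|x _|x xI|x y xI yI|x xI x0].
- by rewrite mulmxDr -scalemxAr slin mulmxDr -scalemxAr.
- exact: (frame_in fAB).
- by rewrite AB sK (frame_id fAB).
- rewrite -{1}(frame_id fAB xI) -{1}(frame_id fAB yI) -(frameE hI fAB) AB sbr.
  exact: (frameE hI fAB).
rewrite -{1}(frame_id fAB xI) (tr_frame hI fAB) -hs.
apply: (gl_form_gt0 (@std_basis_onb R m)); apply: contra x0 => /eqP /linj h.
by rewrite -(frame_id fAB xI) h mulmx0.
Qed.

Lemma exists_star U : ideal mu U -> exists tau, star mu U tau.
Proof.
move: {2}(\dim U) (leqnn (\dim U)) => d; elim: d U => [|d IH] U dU hU.
  have U0 : U = 0%VS by apply/eqP; rewrite -dimv_eq0 -leqn0.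
  exists (fun=> 0); split=> [a x y|x _|x|x y _ _|x].
  - by rewrite scaler0 addr0.
  - exact: mem0v.
  - by rewrite U0 memv0 => /eqP.
  - by rewrite linear0l.
  - by rewrite U0 memv0 => ->.
have [->|U0] := eqVneq U 0%VS.
  by apply: IH => [|x y]; rewrite ?dimv0 // memv0 => /eqP ->; rewrite linear0l linear0r mem0v.
have [I [hI IU I0 minI]] := minimal_ideal hU U0.
have [[t1 st1] dec] := minimal_ideal_star hI I0 minI.
have cap0 := cap_centraliser hI.
pose W := (U :&: centraliser I)%VS.
have hW : ideal mu W by apply: ideal_cap => //; exact: ideal_centraliser.
have [|t2 st2] := IH W _ hW.
  (* [I] and [W] are disjoint inside [U] and [I] is nonzero, so [W] has smaller dimension. *)
  rewrite -ltnS (leq_trans _ dU) //.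
  have IW0 : (I :&: W)%VS = 0%VS.
    by apply/eqP; rewrite -subv0 -cap0 capvS // capvSr.
  have : (\dim (I + W) <= \dim U)%N.
    by rewrite dimvS // subv_add IU capvSl.
  rewrite dimv_disjoint_sum // => /(leq_trans _); apply.
  by rewrite -[X in (X < _)%N]add0n ltn_add2r lt0n dimv_eq0.
have [p hp] := choice dec.
have CW c : c \in W -> c \in centraliser I by rewrite memv_cap => /andP[].
have pE i c : i \in I -> c \in centraliser I -> p (i + c) = i.
  move=> iI cC; have [p1 p2] := hp (i + c).
  apply/eqP; rewrite eq_sym -subr_eq0 -memv0 -cap0 memv_cap rpredB //=.
  have -> : i - p (i + c) = (i + c - p (i + c)) - c by rewrite addrAC addrK.
  by rewrite rpredB.
have pU x : x \in U -> x - p x \in W.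
  by move=> xU; rewrite memv_cap (hp x).2 andbT rpredB // (subvP IU) // (hp x).1.
have plin a x y : p (a *: x + y) = a *: p x + p y.
  have := @pE (a *: p x + p y) (a *: (x - p x) + (y - p y)).
  rewrite addrACA -scalerDr ![p _ + (_ - p _)]addrC !subrK; apply.
    by rewrite rpredD ?rpredZ ?(hp _).1.
  by rewrite rpredD ?rpredZ ?(hp _).2.
(* [p] projects the whole space onto [I] along its centraliser, so [tau] is conjugate-linear
   everywhere, as [star_lin] asks. *)
pose tau x := t1 (p x) + t2 (x - p x).
have tE i c : i \in I -> c \in W -> tau (i + c) = t1 i + t2 c.
  by move=> iI cW; rewrite /tau pE ?CW // addrAC subrr add0r.
have split_ x : x \in U -> exists i c, [/\ i \in I, c \in W & x = i + c].
  move=> xU; exists (p x), (x - p x); split; [exact: (hp x).1 | exact: pU | by rewrite addrC subrK].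
have ci0 i c : i \in I -> c \in W -> mu c i = 0.
  by move=> iI /CW /centraliserP; apply.
have ic0 i c : i \in I -> c \in W -> mu i c = 0.
  by move=> iI cW; rewrite anti ci0 // oppr0.
(* L_c L_i = 0, since L_i maps into [I], which c centralises; the cross terms of the trace form
   vanish. *)
have tr0 i c : i \in I -> c \in W -> \tr (lop mu i *m lop mu c) = 0.
  move=> iI cW; rewrite mxtrace_mulC; have -> : lop mu c *m lop mu i = 0; last by rewrite mxtrace0.
  apply: mulmx_inj => x; rewrite -mulmxA !lopE mul0mx ci0 //.
  exact: ideal_meml.
exists tau; split=> [a x y|x xU|x xU|x y xU yU|x xU x0].
- rewrite /tau plin (star_lin st1).
  have -> : a *: x + y - (a *: p x + p y) = a *: (x - p x) + (y - p y).
    by rewrite opprD addrACA scalerBr.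
  by rewrite (star_lin st2) addrACA -scalerDr.
- have [i [c [iI cW ->]]] := split_ x xU; rewrite tE // rpredD //.
    by rewrite (subvP IU) // (star_in st1).
  by have := star_in st2 cW; rewrite memv_cap => /andP[].
- have [i [c [iI cW ->]]] := split_ x xU.
  by rewrite tE // tE ?(star_in st1) ?(star_in st2) // (starK st1) // (starK st2).
- have [i [c [iI cW ->]]] := split_ x xU; have [j [d' [jI dW ->]]] := split_ y yU.
  have bE u v w z : u \in I -> v \in I -> w \in W -> z \in W ->
      mu (u + w) (v + z) = mu u v + mu w z.
    by move=> uI vI wW zW; rewrite linearDl !linearDr (ic0 u z) // (ci0 v w) // addr0 add0r.
  rewrite bE // !tE ?(ideal_memr _ hI) ?(ideal_memr _ hW) // bE ?(star_in st1) ?(star_in st2) //.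
  by rewrite (star_bracket st1) // (star_bracket st2).
have [i [c [iI cW xE]]] := split_ x xU; rewrite xE tE // in x0 *.
have lopD y z : lop mu (y + z) = lop mu y + lop mu z by rewrite linearD.
rewrite !lopD mulmxDl !mulmxDr !mxtraceD (tr0 i (t2 c)) ?(star_in st2) //.
rewrite [\tr (lop mu c *m lop mu (t1 i))]mxtrace_mulC (tr0 (t1 i) c) ?(star_in st1) // addr0 add0r.
have pos1 : 0 <= \tr (lop mu i *m lop mu (t1 i)).
  by have [->|i0] := eqVneq i 0; [rewrite linear0 mul0mx mxtrace0 | exact/ltW/(star_pos st1)].
have pos2 : 0 <= \tr (lop mu c *m lop mu (t2 c)).
  by have [->|c0] := eqVneq c 0; [rewrite linear0 mul0mx mxtrace0 | exact/ltW/(star_pos st2)].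
have [i0|i0] := eqVneq i 0; last by rewrite ltr_wpDr // (star_pos st1).
by rewrite ltr_wpDl // (star_pos st2) //; apply: contra x0 => /eqP ->; rewrite i0 addr0.
Qed.

End Decomposition.

(** * Semisimple orbits contain a point of scalar moment map; the minimum of [Fn] *)

Lemma semisimple_scalar_moment (R : realType) n (dot : herm_prod R n) X (mu : bilin R n) :
  orthonormal_basis dot X -> semisimple_lie mu ->
  exists2 g : 'M[R[i]]_n, g \in unitmx & exists a, moment dot X (gl_bilin g mu) = a%:M.
Proof.
move=> hX /semisimple_lieP [lie triv].
have [|tau htau] := exists_star lie triv (U := fullv); first by move=> x y; rewrite !memvf.
exact: star_minimal hX lie htau.
Qed.

Lemma orbit_nonzero (R : realType) n (g : 'M[R[i]]_n) (mu : bilin R n) :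
  g \in unitmx -> nonzero mu -> nonzero (gl_bilin g mu).
Proof.
move=> ug [x [y xy]]; exists (g *m x), (g *m y); rewrite gl_bilinE /gl_act !mulKmx //.
by apply: contra xy => /eqP h; rewrite -(mulKmx ug (mu x y)) h mulmx0.
Qed.

Lemma orbit_leibniz (R : realType) n (g : 'M[R[i]]_n) (mu : bilin R n) :
  g \in unitmx -> leibniz mu -> leibniz (gl_bilin g mu).
Proof.
by move=> ug h x y z; rewrite !gl_bilinE /gl_act !mulKmx // -mulmxDr h.
Qed.

Theorem theorem4p7 (R : realType) (n : nat)
    (dot : herm_prod R n) (X : 'I_n -> 'cV[R[i]]_n)
    (hX : orthonormal_basis dot X)
    (hn : exists s : bilin R n, semisimple_lie s)
    (mu : bilin R n) (hmu0 : nonzero mu) (hmu : leibniz mu) :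
  ((exists lam : bilin R n, in_gl_orbit mu lam /\ Fn_minimal dot X lam)
     <-> semisimple_lie mu)
  /\ (forall lam : bilin R n, in_gl_orbit mu lam -> Fn_minimal dot X lam ->
        Fn dot X lam = 4 / n%:R).
Proof.
have scalar_Fn (nu : bilin R n) a : nonzero nu -> moment dot X nu = a%:M -> Fn dot X nu = 4 / n%:R.
  move=> nu0 ha; apply/(Fn_bound hX nu0).2; rewrite ha; congr (_%:M).
  (* The trace -2 forces the scalar to be -2/n. *)
  have := tr_moment hX nu0; rewrite ha mxtrace_scalar -[a *+ n]mulr_natr => e.
  have n0 : n%:R != 0 :> R[i].
    by apply/eqP => n0; move/eqP: e; rewrite n0 mulr0 eq_sym oppr_eq0 pnatr_eq0.
  by apply: (mulIf n0); rewrite e mulNr divfK.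
have nonzero_dim : (0 < n)%N.
  rewrite lt0n; apply/eqP => n0; case: hmu0 => x [y /eqP []]; apply/colP => i.
  by move: (ltn_ord i); rewrite {2}n0.
have semisimple_nonzero (s : bilin R n) : semisimple_lie s -> nonzero s.
  move=> /semisimple_lieP[_ triv]; apply: contrapT => no.
  have s0 x y : s x y = 0 by apply: contrapT => /eqP h; apply: no; exists x, y.
  have := triv fullv _ (fun x y _ _ => s0 x y).
  have h : ideal s fullv by move=> x y _; rewrite !memvf.
  move=> /(_ h) /(congr1 (fun U : {vspace _} => \dim U)).
  by rewrite dimv0 dimvf dim_matrix mulr1 => n0; rewrite n0 in nonzero_dim.
(* The orbit of the semisimple algebra given by [hn] contains a Leibniz point of value 4/n, so a
   minimum cannot exceed the general lower bound. *)
have minimalE (lam : bilin R n) : Fn_minimal dot X lam -> Fn dot X lam = 4 / n%:R.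
  move=> [lam0 _ hmin]; have [s hs] := hn.
  have [g ug [a ha]] := semisimple_scalar_moment hX hs.
  have g0 := orbit_nonzero ug (semisimple_nonzero s hs).
  have gl := orbit_leibniz ug (lie_leibniz hs.1).
  have := hmin _ g0 gl; rewrite (scalar_Fn _ _ g0 ha) => h.
  by apply/le_anti; rewrite h (Fn_bound hX lam0).1.
split; last by move=> lam _; exact: minimalE.
split=> [[lam [[g [c [ug c0 lamE]]] hmin]]|hs].
  have [lam0 lei _] := hmin.
  have hm := (Fn_bound hX lam0).2.1 (minimalE lam hmin).
  have a0 : - (2 / n%:R) != 0 :> R[i].
    by rewrite oppr_eq0 mulf_neq0 ?invr_neq0 // pnatr_eq0 // -lt0n.
  (* Equality in the bound makes the moment map at [lam] the nonzero scalar -2/n; the conclusions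
     for [lam] are then carried back to [mu] along [g]. *)
  have [lie triv] := scalar_moment_semisimple hX lei lam0 a0 hm.

  apply/semisimple_lieP; split; last exact: (orbit_abelian_ideals ug lamE triv).
  apply: leibniz_alternating_lie => //; apply: (orbit_alternating ug c0 lamE).
  exact: lie.1.
(* Conversely, the point of scalar moment map in the orbit of [mu] attains the lower bound. *)
have [g ug [a ha]] := semisimple_scalar_moment hX hs.
have g0 := orbit_nonzero ug hmu0.
exists (gl_bilin g mu); split.
  by exists g, 1; split=> //; [exact: oner_neq0 | move=> x y; rewrite scale1r].
split; [exact: g0 | exact: (orbit_leibniz ug hmu) | move=> nu nu0 _].
by rewrite (scalar_Fn _ _ g0 ha) (Fn_bound hX nu0).1.
Qed.
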